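(* Let $k$ be a commutative unital ring. The two coextensions $\overline{sh}_\infty$ and $\sigma\,\overline{sh}_\infty\,\sigma$ of $\overline{sh}$ are not naturally homotopic: there do not exist $k$-linear maps $h^{(i)}:(\Omega(A)\otimes\Omega(B))_n\to\Omega^{n+2i+1}(A\otimes B)$ ($i,n\ge0$), natural in the unital $k$-algebras $A,B$, such that $h=\sum_{i\ge 0}h^{(i)}$ satisfies $$\sigma\,\overline{sh}_\infty\,\sigma-\overline{sh}_\infty=(b+B)h+h(b+B).$$
   Context: For a unital $k$-algebra $A$, $\bar A=A/k1$ and $\Omega^n(A)=A\otimes\bar A^{\otimes n}$ (elements $a_0\mathrm da_1\cdots\mathrm da_n$) is the normalized Hochschild complex; $\Omega(A)$ is the differential graded algebra of noncommutative forms. $b(\omega\,\mathrm da)=(-1)^{|\omega|}(\omega a-a\omega)$ ($b=0$ on $\Omega^0$), $B(a_0\mathrm da_1\cdots\mathrm da_n)=\sum_{i=0}^n(-1)^{ni}\mathrm da_{n-i+1}\cdots\mathrm da_n\mathrm da_0\cdots\mathrm da_{n-i}$; on $\Omega(A)\otimes\Omega(B)$, $b(x\otimes y)=bx\otimes y+(-1)^{|x|}x\otimes by$ and similarly for $B$. In composites of operators, $B$ denotes Connes' operator. In $\Omega(A\otimes B)$ write $a$ for $a\otimes1$ and $b$ for $1\otimes b$. $\sigma$ denotes both the flip $\Omega(A)\otimes\Omega(B)\to\Omega(B)\otimes\Omega(A)$, $x_p\otimes y_q\mapsto(-1)^{pq}y_q\otimes x_p$, and the isomorphism $\Omega(A\otimes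 B)\to\Omega(B\otimes A)$ induced by exchanging the two tensor factors; thus $\sigma\,\overline{sh}_\infty\,\sigma$ is again a map $\Omega(A)\otimes\Omega(B)\to\Omega(A\otimes B)$. $Sh_{p,q}$ denotes the sum of all $(p,q)$-shuffles of the listed sequence, multiplied by their signatures, each read as a product. $$\overline{sh}(a_0\mathrm da_1\cdots\mathrm da_p\otimes b_0\mathrm db_1\cdots\mathrm db_q)=(a_0\otimes b_0)Sh_{p,q}(\mathrm da_1,\dots,\mathrm da_p,\mathrm db_1,\dots,\mathrm db_q).$$ $\varphi_n:\Omega^n(A\otimes B)\to\Omega^{n+1}(A\otimes B)$ is $\varphi_n=\sum_{0<p\le r\le n}(-1)^{n+r}\varphi_n^{r,p}$ with, for $\omega\in\Omega^{n-r}(A\otimes B)$, $$\varphi_n^{r,p}(\omega\,\mathrm d(a_1\otimes b_1)\cdots\mathrm d(a_r\otimes b_r))=(a_{p+1}\cdots a_r\otimes1)\,\omega\,\mathrm d(b_1\cdots b_p)\,Sh_{p,r-p}(\mathrm da_1,\dots,\mathrm da_p,\mathrm db_{p+1},\dots,\mathrm db_r).$$ Put $\varphi_\infty=\sum_{m\ge0}(\varphi B)^m\varphi$ and $\overline{sh}_\infty=(1+\varphi_\infty B)\overline{sh}$; it is a coextension of $\overline{sh}$ of length 2, i.e. $\overline{sh}_\infty=\overline{sh}+\varphi B\,\overline{sh}$, and it commutes with $b+B$. The operators $\sigma$ commute with $b$ and $B$. *)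

(* Defs.v *)
From HB Require Import structures.
From mathcomp Require Import all_boot all_algebra all_fingroup.
From mathcomp Require Import boolp zify.
From mathcomp Require Import freeg ring_quotient generic_quotient.
Set Implicit Arguments.
Unset Strict Implicit.
Unset Printing Implicit Defensive.
Import GRing.Theory.
Local Open Scope ring_scope.
Local Open Scope quotient_scope.

Section FreeLift.
Variables (k : comNzRingType) (X : choiceType) (P : lmodType k).
Implicit Types (f g : X -> P) (D : {freeg X / k}).

Lemma fglift_linear f : linear (fglift f).
Proof.
have fgD u v : fglift f (u - v) = fglift f u - fglift f v.
  exact: lift_is_additive.
pose F : {additive {freeg X / k} -> P} :=
  HB.pack (fglift f) (GRing.isZmodMorphism.Build _ _ (fglift f) fgD).
have fgS (s : seq X) (G : X -> {freeg X / k}) :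
    fglift f (\sum_(x <- s) G x) = \sum_(x <- s) fglift f (G x).
  exact: (raddf_sum F).
have fgN u : fglift f (- u) = - fglift f u by exact: (raddfN F).
have fgZ c u : fglift f (c *: u) = c *: fglift f u.
  rewrite -[in RHS](freeg_sumE u) fgS scaler_sumr.
  have -> : c *: u = \sum_(x <- dom u) << c * coeff x u *g x >>.
    by apply/eqP/freeg_eqP=> x; rewrite coeffZ -coeff_fgscale.
  by rewrite fgS; apply: eq_bigr => x _; rewrite !liftU scalerA.
by move=> c u v; rewrite -[v in LHS]opprK fgD fgZ fgN opprK.
Qed.

Lemma eq_fglift f g : f =1 g -> fglift f =1 fglift g.
Proof.
by move=> fg D; unlock fglift; apply: eq_bigr => x _; rewrite fg.
Qed.

Lemma fglift_comb c f g D :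
  fglift (fun x => c *: f x + g x) D = c *: fglift f D + fglift g D.
Proof.
unlock fglift; rewrite /lift /prelift scaler_sumr -big_split /=.
by apply: eq_bigr => x _; rewrite scalerDr !scalerA mulrC.
Qed.

Lemma fglift_rel f c (x y z : X) :
  fglift f (<< x >> - (c *: << y >> + << z >>)) = f x - (c *: f y + f z).
Proof.
pose F : {linear {freeg X / k} -> P} :=
  HB.pack (fglift f) (GRing.isLinear.Build _ _ _ _ _ (fglift_linear f)).
have FU w : fglift f << w >> = f w by rewrite liftU scale1r.
have := linearB F << x >> (c *: << y >> + << z >>).
by rewrite /= fglift_linear !FU.
Qed.

End FreeLift.

(* The k-module with generators X and relations R: the free module modulo the
   submodule generated by R. *)
Section Presented.
Variables (k : comNzRingType) (X : choiceType) (R : {freeg X / k} -> Prop).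

Definition rel_span (v : {freeg X / k}) : Prop :=
  forall S : {freeg X / k} -> Prop,
    S 0 -> (forall c u w, S u -> S w -> S (c *: u + w)) ->
    (forall u, R u -> S u) -> S v.

Definition rel_pred : {pred {freeg X / k}} := fun v => `[< rel_span v >].

Lemma rel_spanP v : reflect (rel_span v) (v \in rel_pred).
Proof. exact: asboolP. Qed.

Lemma rel_pred_submod : submod_closed rel_pred.
Proof.
split; first by apply/rel_spanP => P P0.
move=> c u w /rel_spanP Hu /rel_spanP Hw; apply/rel_spanP => P P0 PD PR.
exact: (PD c u w (Hu P P0 PD PR) (Hw P P0 PD PR)).
Qed.

HB.instance Definition _ :=
  GRing.isSubmodClosed.Build k {freeg X / k} rel_pred
    (GRing.submod_closed_semi rel_pred_submod).

Definition pmod : Type := Quotient.quot (rel_pred : zmodClosed _).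

HB.instance Definition _ := GRing.Zmodule.on pmod.

Definition pclass (v : {freeg X / k}) : pmod :=
  \pi_(Quotient.quot (rel_pred : zmodClosed _)) v.

Definition prepr (q : pmod) : {freeg X / k} := repr q.

Definition pgen (x : X) : pmod := pclass << x >>.

Lemma prepr_class v : v - prepr (pclass v) \in rel_pred.
Proof. by rewrite Quotient.idealrBE reprK. Qed.

Lemma preprK q : pclass (prepr q) = q.
Proof. exact: reprK. Qed.

Lemma pclassP u v : u - v \in rel_pred -> pclass u = pclass v.
Proof. by rewrite Quotient.idealrBE => /eqP. Qed.

Lemma pclassB u v : pclass (u - v) = pclass u - pclass v.
Proof. by rewrite /pclass !piE. Qed.

Lemma pclassD u v : pclass (u + v) = pclass u + pclass v.
Proof. by rewrite /pclass !piE. Qed.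

Definition pscale (c : k) (q : pmod) : pmod := pclass (c *: prepr q).

Lemma pscaleE c v : pscale c (pclass v) = pclass (c *: v).
Proof.
apply: pclassP; rewrite -scalerBr rpredZ // -opprB rpredN.
exact: prepr_class.
Qed.

Fact pscaleA a b q : pscale a (pscale b q) = pscale (a * b) q.
Proof. by rewrite -(preprK q) !pscaleE scalerA. Qed.
Fact pscale1 : left_id 1 pscale.
Proof. by move=> q; rewrite -(preprK q) pscaleE scale1r. Qed.
Fact pscaleDr : right_distributive pscale +%R.
Proof.
move=> a p q; rewrite -(preprK q) -(preprK p) -pclassD !pscaleE.
by rewrite scalerDr pclassD.
Qed.
Fact pscaleDl q : {morph pscale^~ q : a b / a + b}.
Proof. by move=> a b; rewrite -(preprK q) !pscaleE scalerDl pclassD. Qed.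

HB.instance Definition _ :=
  GRing.Zmodule_isLmodule.Build k pmod pscaleA pscale1 pscaleDr pscaleDl.

Lemma pclass_linear : linear pclass.
Proof. by move=> c u v; rewrite pclassD -pscaleE. Qed.

HB.instance Definition _ :=
  GRing.isLinear.Build k {freeg X / k} pmod *:%R pclass pclass_linear.

Lemma pclass_rel u : R u -> pclass u = 0.
Proof.
move=> Ru; rewrite -[RHS](raddf0 pclass); apply: pclassP.
by rewrite subr0; apply/rel_spanP => S _ _; apply.
Qed.

Lemma pgen_rel c x y z :
  R (<< x >> - (c *: << y >> + << z >>)) -> pgen x = c *: pgen y + pgen z.
Proof.
move=> /pclass_rel; rewrite raddfB /= => /eqP; rewrite subr_eq0 => /eqP.
by rewrite pclass_linear.
Qed.

Lemma pmod_ind (Q : pmod -> Prop) :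
  Q 0 -> (forall c x q, Q q -> Q (c *: pgen x + q)) -> forall q, Q q.
Proof.
move=> Q0 QD q; rewrite -(preprK q) -(freeg_sumE (prepr q)).
elim: (dom _) => [|x s IHs]; first by rewrite big_nil raddf0.
rewrite big_cons raddfD /=.
have -> : << coeff x (prepr q) *g x >> = coeff x (prepr q) *: << x >> :> {freeg X / k}.
  by apply/eqP/freeg_eqP => y; rewrite coeffZ !coeffU mul1r.
by rewrite linearZ; apply: QD.
Qed.

(* Total in f: f is applied to a representative.  When f kills the relations
   this is the induced linear map, see plift_linear and plift_gen. *)
Definition plift (P : lmodType k) (f : X -> P) (q : pmod) : P :=
  fglift f (prepr q).

Section Plift.
Variables (P : lmodType k) (f : X -> P).
Hypothesis fR : forall u, R u -> fglift f u = 0.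

Lemma fglift_span u : u \in rel_pred -> fglift f u = 0.
Proof.
move=> /rel_spanP Hu; apply: (Hu (fun v => fglift f v = 0)) => //; last first.
  by move=> c v w fv fw; rewrite fglift_linear fv fw scaler0 addr0.
pose F : {linear {freeg X / k} -> P} :=
  HB.pack (fglift f) (GRing.isLinear.Build _ _ _ _ _ (fglift_linear f)).
exact: (raddf0 F).
Qed.

Lemma plift_class u : plift f (pclass u) = fglift f u.
Proof.
have := fglift_linear f (-1) (prepr (pclass u)) u; rewrite !scaleN1r => fB.
have := fglift_span (prepr_class u); rewrite addrC fB addrC => /eqP.
by rewrite subr_eq0 => /eqP.
Qed.

Lemma plift_linear : linear (plift f).
Proof.
move=> c p q; rewrite -(preprK p) -(preprK q) -linearP !plift_class.
exact: fglift_linear.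
Qed.

Lemma plift_gen x : plift f (pgen x) = f x.
Proof. by rewrite plift_class liftU scale1r. Qed.
End Plift.

Lemma eq_plift (P : lmodType k) (f g : X -> P) : f =1 g -> plift f =1 plift g.
Proof. by move=> fg q; apply: eq_fglift. Qed.

Lemma plift0 (P : lmodType k) q : plift (fun=> 0 : P) q = 0.
Proof.
by rewrite /plift; unlock fglift; rewrite /lift /prelift big1 // => x; rewrite scaler0.
Qed.

Lemma plift_comb (P : lmodType k) c (f g : X -> P) q :
  plift (fun x => c *: f x + g x) q = c *: plift f q + plift g q.
Proof. exact: fglift_comb. Qed.

End Presented.

Section TensorProduct.
Variables (k : comNzRingType) (M N : lmodType k).

Inductive tens_rel : {freeg (M * N)%type / k} -> Prop :=
| TensRelL c m m' n :
    tens_rel (<< (c *: m + m', n) >> - (c *: << (m, n) >> + << (m', n) >>))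
| TensRelR c m n n' :
    tens_rel (<< (m, c *: n + n') >> - (c *: << (m, n) >> + << (m, n') >>)).

Definition tens : Type := pmod tens_rel.
HB.instance Definition _ := GRing.Lmodule.on tens.

Definition tpure (m : M) (n : N) : tens := pgen tens_rel (m, n).

Definition bilin (P : lmodType k) (f : M -> N -> P) : Prop :=
  (forall n, linear (f^~ n)) /\ (forall m, linear (f m)).

Definition tlift (P : lmodType k) (f : M -> N -> P) (t : tens) : P :=
  plift (fun x => f x.1 x.2) t.

Lemma tpure_bilin : bilin tpure.
Proof.
split=> [n|m] c x y.
  exact: (pgen_rel (TensRelL c x y n)).
exact: (pgen_rel (TensRelR c m x y)).
Qed.

Lemma tens_ind (Q : tens -> Prop) :
  Q 0 -> (forall m n t, Q t -> Q (tpure m n + t)) -> forall t, Q t.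
Proof.
move=> Q0 QD; apply: pmod_ind => // c [m n] t /(QD (c *: m) n).
have [/(_ n c m 0) /= lin _] := tpure_bilin.
have [/(_ n (-1) 0 0) /= lin0 _] := tpure_bilin.
by move: lin; rewrite !(scaler0, addr0) scaleN1r addNr in lin0 * => ->; rewrite lin0 addr0.
Qed.

Section Lift.
Variables (P : lmodType k) (f : M -> N -> P).
Hypothesis fb : bilin f.

Lemma bilin_rel u : tens_rel u -> fglift (fun x => f x.1 x.2) u = 0.
Proof.
by case: fb => fl fr [] c m n n'; rewrite fglift_rel /= ?fl ?fr subrr.
Qed.

Lemma tlift_pure m n : tlift f (tpure m n) = f m n.
Proof. exact: (plift_gen bilin_rel (m, n)). Qed.

Lemma tlift_linear : linear (tlift f).
Proof. exact: plift_linear bilin_rel. Qed.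
End Lift.

Lemma eq_tlift (P : lmodType k) (f g : M -> N -> P) t :
  f =2 g -> tlift f t = tlift g t.
Proof. by move=> fg; apply: eq_plift => -[m n]; apply: fg. Qed.

Lemma tlift_comb (P : lmodType k) c (f g : M -> N -> P) t :
  tlift (fun m n => c *: f m n + g m n) t = c *: tlift f t + tlift g t.
Proof. exact: plift_comb. Qed.

Lemma tlift0 (P : lmodType k) t : tlift (fun _ _ => 0 : P) t = 0.
Proof. exact: plift0. Qed.

End TensorProduct.

Notation "m ⊗ n" := (tpure m n) (at level 40, left associativity) : ring_scope.

Section TensorLinear.
Variables (k : comNzRingType) (M N : lmodType k).

Lemma tens_eq (P : lmodType k) (f g : tens M N -> P) :
  linear f -> linear g -> (forall m n, f (m ⊗ n) = g (m ⊗ n)) -> f =1 g.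
Proof.
move=> fl gl fg; apply: tens_ind => [|m n t].
  have f0 : f 0 = 0 by have := fl (-1) 0 0; rewrite scaler0 addr0 scaleN1r addNr.
  by have := gl (-1) 0 0; rewrite scaler0 addr0 scaleN1r addNr f0.
by rewrite -[_ ⊗ _]scale1r fl gl fg => ->.
Qed.
End TensorLinear.

Section TensorMap.
Variables (k : comNzRingType) (M N M' N' : lmodType k).

Definition tmap (f : M -> M') (g : N -> N') : tens M N -> tens M' N' :=
  tlift (fun m n => f m ⊗ g n).

Lemma tmap_bilin (f : M -> M') (g : N -> N') :
  linear f -> linear g -> bilin (fun m n => f m ⊗ g n).
Proof.
have [bl br] := tpure_bilin M' N'.
by move=> fl gl; split=> [n|m] c x y; rewrite ?fl ?gl ?bl ?br.
Qed.

Lemma tmapE (f : M -> M') (g : N -> N') m n :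
  linear f -> linear g -> tmap f g (m ⊗ n) = f m ⊗ g n.
Proof. by move=> fl gl; rewrite /tmap tlift_pure //; apply: tmap_bilin. Qed.

Lemma tmap_linear (f : M -> M') (g : N -> N') :
  linear f -> linear g -> linear (tmap f g).
Proof. by move=> fl gl; apply: tlift_linear; apply: tmap_bilin. Qed.
End TensorMap.

(* Unital associative k-algebras, the zero algebra included.  MathComp's algType
   requires 1 != 0, a property that A (x) B need not inherit from A and B. *)
HB.mixin Record Lmodule_isUnitalAlgebra (k : pzRingType) A
    of GRing.Lmodule k A := {
  kone : A;
  kmul : A -> A -> A;
  kmulA : associative kmul;
  kmul1x : left_id kone kmul;
  kmulx1 : right_id kone kmul;
  kmul_linearl : forall y, linear (kmul^~ y);
  kmul_linearr : forall x, linear (kmul x)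
}.

#[short(type="kalgType")]
HB.structure Definition UnitalAlgebra (k : pzRingType) :=
  {A of GRing.Lmodule k A & Lmodule_isUnitalAlgebra k A}.

Notation "x ∙ y" := (kmul x y) (at level 40, left associativity) : ring_scope.
Arguments kone {k s}.

Definition kalg_of (k : comNzRingType) (A : algType k) : Type := A.

Section KalgOf.
Variables (k : comNzRingType) (A : algType k).
HB.instance Definition _ := GRing.Lmodule.on (kalg_of A).
Fact kalg_of_linl (y : A) : linear ( *%R^~ y : A -> A).
Proof. by move=> c u v; rewrite mulrDl scalerAl. Qed.
Fact kalg_of_linr (x : A) : linear ( *%R x : A -> A).
Proof. by move=> c u v; rewrite mulrDr scalerAr. Qed.
HB.instance Definition _ := Lmodule_isUnitalAlgebra.Build k (kalg_of A)
  (@mulrA A) (@mul1r A) (@mulr1 A) kalg_of_linl kalg_of_linr.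
End KalgOf.

Definition kalg_morphism (k : comNzRingType) (A B : kalgType k) (f : A -> B) :=
  [/\ linear f, f kone = kone & {morph f : x y / x ∙ y}].

Section TensorAlgebra.
Variables (k : comNzRingType) (A B : kalgType k).
Notation T := (tens A B).

Definition tmul (s t : T) : T :=
  tlift (fun a b => tlift (fun a' b' => (a ∙ a') ⊗ (b ∙ b')) t) s.

Lemma tmul_bilin_in (a : A) (b : B) :
  bilin (fun (a' : A) (b' : B) => (a ∙ a') ⊗ (b ∙ b')).
Proof.
have [bl br] := tpure_bilin A B.
by split=> [n|m] c x y; rewrite kmul_linearr ?bl ?br.
Qed.

Lemma tmul_bilin_out (t : T) :
  bilin (fun (a : A) (b : B) => tlift (fun a' b' => (a ∙ a') ⊗ (b ∙ b')) t).
Proof.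
have [bl br] := tpure_bilin A B.
split=> [n|m] c x y; rewrite -tlift_comb; apply: eq_tlift => a b;
  by rewrite kmul_linearl ?bl ?br.
Qed.

Lemma tmul_linearl t : linear (tmul^~ t).
Proof. exact: tlift_linear (tmul_bilin_out t). Qed.

Lemma tmul_linearr s : linear (tmul s).
Proof.
move=> c x y; rewrite /tmul -tlift_comb; apply: eq_tlift => a b.
exact: tlift_linear (tmul_bilin_in a b) _ _ _.
Qed.

Lemma tmulE a b a' b' : tmul (a ⊗ b) (a' ⊗ b') = (a ∙ a') ⊗ (b ∙ b').
Proof.
by rewrite /tmul (tlift_pure (tmul_bilin_out _)) (tlift_pure (tmul_bilin_in _ _)).
Qed.

Fact tmulA : associative tmul.
Proof.
move=> s t u; move: s.
apply: tens_eq => [c x y|c x y|a b]; rewrite ?tmul_linearl //.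
move: t; apply: tens_eq => [c x y|c x y|a' b'].
- by rewrite tmul_linearl tmul_linearr.
- by rewrite tmul_linearr tmul_linearl.
move: u; apply: tens_eq => [c x y|c x y|a'' b'']; rewrite ?tmul_linearr //.
by rewrite !tmulE !kmulA.
Qed.

Fact tmul1x : left_id (kone ⊗ kone) tmul.
Proof.
apply: tens_eq => [c x y|c x y|a b] //; first by rewrite tmul_linearr.
by rewrite tmulE !kmul1x.
Qed.

Fact tmulx1 : right_id (kone ⊗ kone) tmul.
Proof.
apply: tens_eq => [c x y|c x y|a b] //; first by rewrite tmul_linearl.
by rewrite tmulE !kmulx1.
Qed.

HB.instance Definition _ := Lmodule_isUnitalAlgebra.Build k (tens A B)
  tmulA tmul1x tmulx1 tmul_linearl tmul_linearr.

Lemma tensM (a a' : A) (b b' : B) : (a ⊗ b) ∙ (a' ⊗ b') = (a ∙ a') ⊗ (b ∙ b').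
Proof. exact: tmulE. Qed.

Definition tswap : tens A B -> tens B A := tlift (fun a b => b ⊗ a).

End TensorAlgebra.

Section MultiLinear.
Variables (k : comNzRingType) (V P : lmodType k).
Implicit Types (F : seq V -> P).

Definition multilinear F : Prop := forall s1 c x y s2,
  F (s1 ++ (c *: x + y) :: s2) = c *: F (s1 ++ x :: s2) + F (s1 ++ y :: s2).
End MultiLinear.

Definition normalized (k : comNzRingType) (A : kalgType k) (P : lmodType k)
    (F : seq A -> P) : Prop :=
  forall s1 s2, F (s1 ++ kone :: s2) = 0.

(* Omega A is the direct sum over n of the modules A (x) (A/k1)^(x)n, presented by
   generators form a0 [:: a1; ...; an], written a0 da1 ... dan, which are k-linear
   in each argument and vanish when some ai with i >= 1 is 1.  Right multiplication
   by da1 ... dan appends [:: a1; ...; an] to the list.  Omega_deg n is the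
   summand of index n. *)
Section Forms.
Variables (k : comNzRingType) (A : kalgType k).

Inductive form_rel : {freeg (A * seq A)%type / k} -> Prop :=
| FormRel0 c a b s :
    form_rel (<< (c *: a + b, s) >> - (c *: << (a, s) >> + << (b, s) >>))
| FormRelS c a0 s1 a b s2 :
    form_rel (<< (a0, s1 ++ (c *: a + b) :: s2) >>
              - (c *: << (a0, s1 ++ a :: s2) >> + << (a0, s1 ++ b :: s2) >>))
| FormRel1 a0 s1 s2 : form_rel << (a0, s1 ++ kone :: s2) >>.

Definition Omega : Type := pmod form_rel.
HB.instance Definition _ := GRing.Lmodule.on Omega.

Definition form (a0 : A) (s : seq A) : Omega := pgen form_rel (a0, s).

Definition form_map (P : lmodType k) (F : A -> seq A -> P) : Prop :=
  [/\ forall s, linear (F^~ s), forall a0, multilinear (F a0)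
    & forall a0, normalized (F a0)].

Definition olift (P : lmodType k) (F : A -> seq A -> P) (w : Omega) : P :=
  plift (fun x => F x.1 x.2) w.

Lemma form_form : form_map form.
Proof.
split=> [s c x y|a0 s1 c x y s2|a0 s1 s2].
- exact: (pgen_rel (FormRel0 c x y s)).
- exact: (pgen_rel (FormRelS c a0 s1 x y s2)).
exact: (pclass_rel (FormRel1 a0 s1 s2)).
Qed.

Lemma formDl s : linear (form^~ s). Proof. by case: form_form. Qed.
Lemma form_multilinear a0 : multilinear (form a0). Proof. by case: form_form. Qed.
Lemma form_normalized a0 : normalized (form a0). Proof. by case: form_form. Qed.

Section Lift.
Variables (P : lmodType k) (F : A -> seq A -> P).
Hypothesis Ff : form_map F.

Lemma form_map_rel u : form_rel u -> fglift (fun x => F x.1 x.2) u = 0.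
Proof.
case: Ff => F0 FS F1 [c a b s|c a0 s1 a b s2|a0 s1 s2].
- by rewrite fglift_rel /= F0 subrr.
- by rewrite fglift_rel /= FS subrr.
by rewrite liftU /= F1 scaler0.
Qed.

Lemma oliftE a0 s : olift F (form a0 s) = F a0 s.
Proof. exact: (plift_gen form_map_rel (a0, s)). Qed.

Lemma olift_linear : linear (olift F).
Proof. exact: plift_linear form_map_rel. Qed.
End Lift.

Lemma eq_olift (P : lmodType k) (F G : A -> seq A -> P) w :
  F =2 G -> olift F w = olift G w.
Proof. by move=> fg; apply: eq_plift => -[m n]; apply: fg. Qed.

Lemma olift_comb (P : lmodType k) c (F G : A -> seq A -> P) w :
  olift (fun a s => c *: F a s + G a s) w = c *: olift F w + olift G w.
Proof. exact: plift_comb. Qed.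

Lemma olift0 (P : lmodType k) w : olift (fun _ _ => 0 : P) w = 0.
Proof. exact: plift0. Qed.

Lemma Omega_ind (Q : Omega -> Prop) :
  Q 0 -> (forall a s t, Q t -> Q (form a s + t)) -> forall t, Q t.
Proof.
move=> Q0 QD; apply: pmod_ind => // c [a s] t /(QD (c *: a) s).
have /= lin := formDl s c a 0.
have /= lin0 := formDl s (-1) 0 0.
by move: lin; rewrite !(scaler0, addr0) scaleN1r addNr in lin0 * => ->; rewrite lin0 addr0.
Qed.

Lemma Omega_eq (P : lmodType k) (f g : Omega -> P) :
  linear f -> linear g -> (forall a s, f (form a s) = g (form a s)) -> f =1 g.
Proof.
move=> fl gl fg; apply: Omega_ind => [|a s t].
  have f0 : f 0 = 0 by have := fl (-1) 0 0; rewrite scaler0 addr0 scaleN1r addNr.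
  by have := gl (-1) 0 0; rewrite scaler0 addr0 scaleN1r addNr f0.
by rewrite -[form _ _]scale1r fl gl fg => ->.
Qed.

Definition Omega_deg (n : nat) (w : Omega) : Prop :=
  exists2 l : seq (A * seq A), all (fun x => size x.2 == n) l &
    w = \sum_(x <- l) form x.1 x.2.

End Forms.

Section MultiLinearLemmas.
Variables (k : comNzRingType) (V P : lmodType k).
Implicit Types (F G : seq V -> P).

Lemma multilinear_cons F :
  (forall s, linear (fun x => F (x :: s))) ->
  (forall x, multilinear (fun s => F (x :: s))) -> multilinear F.
Proof. by move=> F1 FS [|z s1] c x y s2; [exact: F1 | exact: FS]. Qed.

Lemma multilinear_comb c F G :
  multilinear F -> multilinear G -> multilinear (fun s => c *: F s + G s).
Proof.
move=> Fm Gm s1 d x y s2; rewrite Fm Gm !scalerDr !scalerA.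
by rewrite [d * c]mulrC addrACA.
Qed.

Lemma multilinear_rev F : multilinear F -> multilinear (fun s => F (rev s)).
Proof. by move=> Fm s1 c x y s2; rewrite !rev_cat !rev_cons -!cats1 -!catA Fm. Qed.

Lemma multilinear_catl F u : multilinear F -> multilinear (fun s => F (u ++ s)).
Proof. by move=> Fm s1 c x y s2; rewrite !catA Fm. Qed.

Lemma multilinear_catr F u : multilinear F -> multilinear (fun s => F (s ++ u)).
Proof. by move=> Fm s1 c x y s2; rewrite -!catA /= Fm. Qed.

Lemma pick_split (l : seq nat) n (s1 s2 : seq V) :
  perm_eq l (iota 0 n) -> (size s1 + (size s2).+1 = n)%N ->
  exists l1 l2, forall x,
    [seq (s1 ++ x :: s2)`_i | i <- l] = l1 ++ x :: l2.
Proof.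
move=> pl sz; have il : size s1 \in l.
  by rewrite (perm_mem pl) mem_iota /= add0n -sz -addSnnS leq_addr.
have ul : uniq l by rewrite (perm_uniq pl) iota_uniq.
case/splitPr: l / il pl ul => l1 l2 _.
rewrite cat_uniq /= negb_or => /and4P[_ /andP[N1 _] N2 _].
exists [seq (s1 ++ 0 :: s2)`_i | i <- l1], [seq (s1 ++ 0 :: s2)`_i | i <- l2] => x.
have eq_nth (l0 : seq nat) : size s1 \notin l0 ->
    [seq (s1 ++ x :: s2)`_i | i <- l0] = [seq (s1 ++ 0 :: s2)`_i | i <- l0].
  move=> Nl; apply/eq_in_map => i il; rewrite !nth_cat; case: ltnP => // le_i.
  case: (ltngtP (size s1) i) le_i => // [lt_i|eq_i] _.
    by rewrite -(subnSK lt_i).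
  by rewrite eq_i il in Nl.
by rewrite map_cat /= nth_cat ltnn subnn /= !eq_nth.
Qed.
End MultiLinearLemmas.

Lemma normalized_catl (k : comNzRingType) (A : kalgType k) (P : lmodType k)
  (F : seq A -> P) u : normalized F -> normalized (fun s => F (u ++ s)).
Proof. by move=> Fn s1 s2; rewrite catA Fn. Qed.

Lemma normalized_rev (k : comNzRingType) (A : kalgType k) (P : lmodType k)
  (F : seq A -> P) : normalized F -> normalized (fun s => F (rev s)).
Proof. by move=> Fn s1 s2; rewrite rev_cat rev_cons cat_rcons Fn. Qed.

Lemma linear_at0 (k : comNzRingType) (U V : lmodType k) (f : U -> V) :
  linear f -> f 0 = 0.
Proof. by move=> fl; have := fl (-1) 0 0; rewrite scaler0 addr0 scaleN1r addNr. Qed.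

Lemma linear_comb (k : comNzRingType) (U V : lmodType k) c (f g : U -> V) :
  linear f -> linear g -> linear (fun x => c *: f x + g x).
Proof.
move=> fl gl d x y; rewrite fl gl !scalerDr !scalerA [d * c]mulrC.
by rewrite addrACA.
Qed.

Section FormMapLemmas.
Variables (k : comNzRingType) (A : kalgType k) (P : lmodType k).
Implicit Types (F G : A -> seq A -> P).

Lemma form_map0 : form_map (fun (_ : A) _ => 0 : P).
Proof. by split=> *; [move=> ???|move=> ?????|]; rewrite ?scaler0 ?addr0. Qed.

Lemma form_map_comb c F G :
  form_map F -> form_map G -> form_map (fun a s => c *: F a s + G a s).
Proof.
move=> [F0 FS F1] [G0 GS G1]; split=> [s|a|a].
- exact: linear_comb.
- exact: multilinear_comb.
by move=> s1 s2; rewrite F1 G1 scaler0 addr0.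
Qed.

Lemma form_map_scale c F : form_map F -> form_map (fun a s => c *: F a s).
Proof.
move=> Ff; have [H0 HS H1] := form_map_comb c Ff form_map0.
split=> [s d x y|a s1 d x y s2|a s1 s2].
- by have := H0 s d x y; rewrite !addr0.
- by have := HS a s1 d x y s2; rewrite !addr0.
by have := H1 a s1 s2; rewrite !addr0.
Qed.

Lemma form_map_sum (I : Type) (r : seq I) (Q : pred I) (F : I -> A -> seq A -> P) :
  (forall i, form_map (F i)) -> form_map (fun a s => \sum_(i <- r | Q i) F i a s).
Proof.
move=> Ff; split=> [s c x y|a s1 c x y s2|a s1 s2].
- rewrite scaler_sumr -big_split; apply: eq_bigr => i _.
  by case: (Ff i) => F0 _ _; rewrite F0.
- rewrite scaler_sumr -big_split; apply: eq_bigr => i _.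
  by case: (Ff i) => _ FS _; rewrite FS.
by rewrite big1 // => i _; case: (Ff i) => _ _ Fn; apply: Fn.
Qed.

Lemma form_map_size (F : nat -> A -> seq A -> P) :
  (forall n, form_map (F n)) -> form_map (fun a s => F (size s) a s).
Proof.
move=> Ff; split=> [s|a s1 c x y s2|a s1 s2].
- by case: (Ff (size s)).
- rewrite !size_cat /=; by case: (Ff (size s1 + (size s2).+1)%N) => _ Fm _; apply: Fm.
- by case: (Ff (size (s1 ++ kone :: s2))) => _ _ Fn; apply: Fn.
Qed.

End FormMapLemmas.

Section Hochschild.
Variables (k : comNzRingType) (A : kalgType k).
Notation O := (Omega A).

(* Right multiplication by dc. *)
Definition dapp (c : A) : O -> O := olift (fun a0 s => form a0 (rcons s c)).

Definition lact (a : A) : O -> O := olift (fun a0 s => form (a ∙ a0) s).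

(* The product (a0 da1 ... dan) c, where t lists an, ..., a1, by the rule
   (w dx) c = w d(xc) - (w x) dc; see ract0 and ract_rcons. *)
Fixpoint ract_word (a0 : A) (t : seq A) (c : A) : O :=
  if t is x :: t' then
    form a0 (rcons (rev t') (x ∙ c)) - dapp c (ract_word a0 t' x)
  else form (a0 ∙ c) [::].

Definition ract (c : A) : O -> O := olift (fun a0 s => ract_word a0 (rev s) c).

Definition hochschild_word (a0 : A) (s : seq A) : O :=
  if rev s is a :: t then
    (-1) ^+ size t *: (ract a (form a0 (rev t)) - lact a (form a0 (rev t)))
  else 0.

Definition hochschild_b : O -> O := olift hochschild_word.

(* rotr i moves the last i entries of a0, ..., an to the front. *)
Definition connes_word (a0 : A) (s : seq A) : O :=
  \sum_(i < (size s).+1) (-1) ^+ (size s * i) *: form kone (rotr i (a0 :: s)).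

Definition connes_B : O -> O := olift connes_word.

(* w |-> (-1)^|w| w *)
Definition omega_sign : O -> O :=
  olift (fun a0 s => (-1) ^+ size s *: form a0 s).

Lemma dapp_form_map c : form_map (fun (a0 : A) s => form a0 (rcons s c)).
Proof.
split=> [s|a0|a0]; first exact: formDl.
  move=> s1 d x y s2; rewrite !rcons_cat !rcons_cons; exact: form_multilinear.
by move=> s1 s2; rewrite rcons_cat rcons_cons form_normalized.
Qed.

Lemma dappE c a0 s : dapp c (form a0 s) = form a0 (rcons s c).
Proof. exact: oliftE (dapp_form_map c) _ _. Qed.

Lemma dapp_linear c : linear (dapp c).
Proof. exact: olift_linear (dapp_form_map c). Qed.

Lemma dapp_linearl w : linear (dapp^~ w).
Proof.
move=> c x y; rewrite -olift_comb; apply: eq_olift => a0 s.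
rewrite -!cats1; exact: form_multilinear.
Qed.

Lemma dapp_kone w : dapp kone w = 0.
Proof.
rewrite -[RHS](olift0 _ w); apply: eq_olift => a0 s.
rewrite -cats1; exact: form_normalized.
Qed.

Lemma lact_form_map a : form_map (fun (a0 : A) s => form (a ∙ a0) s).
Proof.
split=> [s c x y|a0|a0]; first by rewrite kmul_linearr formDl.
  exact: form_multilinear.
exact: form_normalized.
Qed.

Lemma lactE a a0 s : lact a (form a0 s) = form (a ∙ a0) s.
Proof. exact: oliftE (lact_form_map a) _ _. Qed.

Lemma lact_linear a : linear (lact a).
Proof. exact: olift_linear (lact_form_map a). Qed.

Lemma ract_word_linearr a0 t : linear (ract_word a0 t).
Proof.
elim: t => [|x t IHt] c u v /=; first by rewrite kmul_linearr formDl.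
rewrite kmul_linearr -!cats1 form_multilinear dapp_linearl.
by rewrite scalerBr opprD addrACA.
Qed.

Lemma ract_word_linearl t c : linear (fun a0 => ract_word a0 t c).
Proof.
elim: t c => [|x t IHt] c d u v /=; first by rewrite kmul_linearl formDl.
by rewrite formDl IHt dapp_linear scalerBr opprD addrACA.
Qed.

Lemma ract_word_multilinear a0 c : multilinear (fun t => ract_word a0 t c).
Proof.
move=> s1 d u v s2; elim: s1 c => [|x s1 IHs] c /=.
  rewrite kmul_linearl -!cats1 form_multilinear ract_word_linearr dapp_linear.
  by rewrite scalerBr opprD addrACA.
rewrite IHs dapp_linear -!cats1.
have := multilinear_rev (multilinear_catr [:: x ∙ c] (@form_multilinear _ A a0)).
by move=> /= ->; rewrite scalerBr opprD addrACA.
Qed.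

Lemma ract_word1 a0 t : ract_word a0 t kone = form a0 (rev t).
Proof.
case: t => [|x t] /=; first by rewrite kmulx1.
by rewrite dapp_kone subr0 kmulx1 rev_cons.
Qed.

Lemma ract_word_normalized a0 c : normalized (fun t => ract_word a0 t c).
Proof.
move=> s1 s2; elim: s1 c => [|x s1 IHs] c /=.
  by rewrite ract_word1 dappE kmul1x subrr.
rewrite IHs (linear_at0 (dapp_linear c)) subr0 rev_cat rev_cons rcons_cat.
by rewrite cat_rcons form_normalized.
Qed.

Lemma ract_form_map c : form_map (fun (a0 : A) s => ract_word a0 (rev s) c).
Proof.
split=> [s|a0|a0]; first exact: ract_word_linearl.
  exact: (multilinear_rev (@ract_word_multilinear a0 c)).
exact: (normalized_rev (@ract_word_normalized a0 c)).
Qed.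

Lemma ract_linear c : linear (ract c).
Proof. exact: olift_linear (ract_form_map c). Qed.

Lemma ractE c a0 s : ract c (form a0 s) = ract_word a0 (rev s) c.
Proof. exact: oliftE (ract_form_map c) _ _. Qed.

Lemma ract0 c a0 : ract c (form a0 [::]) = form (a0 ∙ c) [::].
Proof. by rewrite ractE. Qed.

Lemma ract_rcons c a0 s a :
  ract c (form a0 (rcons s a)) =
  form a0 (rcons s (a ∙ c)) - dapp c (ract a (form a0 s)).
Proof. by rewrite !ractE rev_rcons /= revK. Qed.

Lemma hochschild_form_map : form_map hochschild_word.
Proof.
pose G n a0 (s : seq A) : O := if s is a :: t then
  (-1) ^+ n *: (ract_word a0 t a - form (a ∙ a0) (rev t)) else 0.
have Gl n s : linear ((G n)^~ s).
  case: s => [|a t] c x y /=; first by rewrite scaler0 addr0.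
  rewrite ract_word_linearl kmul_linearr formDl opprD addrACA -scalerBr.
  by rewrite scalerDr !scalerA mulrC.
have Gm n a0 : multilinear (G n a0).
  apply: multilinear_cons => [t c x y|a] /=.
    rewrite ract_word_linearr kmul_linearl formDl opprD addrACA -scalerBr.
    by rewrite scalerDr !scalerA mulrC.
  move=> s1 c x y s2; rewrite ract_word_multilinear.
  rewrite (multilinear_rev (@form_multilinear _ A (a ∙ a0))).
  by rewrite opprD addrACA -scalerBr scalerDr !scalerA mulrC.
have Gn n a0 : normalized (G n a0).
  move=> [|a s1] s2 /=.
    by rewrite ract_word1 kmul1x subrr scaler0.
  rewrite ract_word_normalized.
  by rewrite (normalized_rev (@form_normalized _ A (a ∙ a0))) subr0 scaler0.
have GE a0 s : hochschild_word a0 s = G (size s).-1 a0 (rev s).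
  rewrite /hochschild_word -[size s]size_rev /G; case: (rev s) => // a t.
  by rewrite ractE lactE revK.
split=> [s c x y|a0 s1 c x y s2|a0 s1 s2]; rewrite !GE.
- exact: Gl.
- rewrite !size_cat; exact: (multilinear_rev (Gm _ a0)).
exact: (normalized_rev (Gn _ a0)).
Qed.

Lemma hochschild_bE a0 s : hochschild_b (form a0 s) = hochschild_word a0 s.
Proof. exact: oliftE hochschild_form_map _ _. Qed.

Lemma hochschild_b_linear : linear hochschild_b.
Proof. exact: olift_linear hochschild_form_map. Qed.

Lemma rotr_pick (i n : nat) (z : seq A) : size z = n ->
  rotr i z = [seq z`_j | j <- rotr i (iota 0 n)].
Proof. by move=> <-; rewrite map_rotr map_nth_iota0 // take_size. Qed.

Lemma connes_form_map : form_map connes_word.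
Proof.
pose C n (i : 'I_n.+1) (a0 : A) (s : seq A) : O :=
  (-1) ^+ (n * i) *: form kone (rotr i (a0 :: s)).
have pi n (i : 'I_n.+1) : perm_eq (rotr i (iota 0 n.+1)) (iota 0 n.+1).
  by rewrite perm_rotr.
split=> [s c x y|a0 s1 c x y s2|a0 s1 s2]; rewrite /connes_word.
- rewrite scaler_sumr -big_split; apply: eq_bigr => i _ /=.
  rewrite !(@rotr_pick i (size s).+1) //.
  have [|l1 [l2 E]] := @pick_split _ A _ _ [::] s (pi (size s) i) => //.
  rewrite !E form_multilinear scalerDr !scalerA; congr (_ + _).
  by rewrite mulrC.
- rewrite !size_cat /= scaler_sumr -big_split; apply: eq_bigr => i _ /=.
  rewrite !(@rotr_pick i (size s1 + (size s2).+1).+1) /= ?size_cat //.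
  have [|l1 [l2 E]] := @pick_split _ A _ _ (a0 :: s1) s2 (pi _ i) => //.
  rewrite -!cat_cons !E form_multilinear scalerDr !scalerA; congr (_ + _).
  by rewrite mulrC.
rewrite !size_cat big1 // => i _.
rewrite !(@rotr_pick i (size s1 + (size s2).+1).+1) /= ?size_cat //.
have [|l1 [l2 E]] := @pick_split _ A _ _ (a0 :: s1) s2 (pi _ i) => //.
by rewrite -cat_cons E form_normalized scaler0.
Qed.

Lemma connes_BE a0 s : connes_B (form a0 s) = connes_word a0 s.
Proof. exact: oliftE connes_form_map _ _. Qed.

Lemma connes_B_linear : linear connes_B.
Proof. exact: olift_linear connes_form_map. Qed.

Lemma omega_sign_form_map :
  form_map (fun (a0 : A) s => (-1) ^+ size s *: form a0 s).
Proof.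
apply: (@form_map_size _ _ _ (fun n a0 s => (-1) ^+ n *: form a0 s)) => n.
exact/form_map_scale/form_form.
Qed.

Lemma omega_signE a0 s : omega_sign (form a0 s) = (-1) ^+ size s *: form a0 s.
Proof. exact: oliftE omega_sign_form_map _ _. Qed.

Lemma omega_sign_linear : linear omega_sign.
Proof. exact: olift_linear omega_sign_form_map. Qed.

End Hochschild.

Section Shuffles.
Variables (k : comNzRingType) (V P : lmodType k).

Definition is_shuffle (p q : nat) (w : 'S_(p + q)) : bool :=
  [forall i : 'I_(p + q), forall j : 'I_(p + q),
    [&& i < j & (j < p) || (p <= i)]%N ==> (w i < w j)%N].

(* The entry z_i moves to position w i. *)
Definition permuted (n : nat) (w : 'S_n) (z : seq V) : seq V :=
  [seq z`_((w^-1)%g i) | i <- enum 'I_n].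

(* Sh_{p,q}(z_0, ..., z_{p+q-1}), each shuffled sequence being placed inside F,
   for instance F := form c to get c Sh_{p,q}(dz_0, ..., dz_{p+q-1}). *)
Definition Sh (p q : nat) (F : seq V -> P) (z : seq V) : P :=
  \sum_(w : 'S_(p + q) | is_shuffle w) (-1) ^+ w *: F (permuted w z).

Lemma permuted_split n (w : 'S_n) (s1 s2 : seq V) :
  (size s1 + (size s2).+1 = n)%N ->
  exists l1 l2, forall x, permuted w (s1 ++ x :: s2) = l1 ++ x :: l2.
Proof.
move=> sz; pose l := [seq val ((w^-1)%g i) | i <- enum 'I_n].
have pl : perm_eq l (iota 0 n).
  rewrite -val_enum_ord /l (map_comp val); apply: perm_map.
  apply: uniq_perm; rewrite ?(map_inj_uniq perm_inj) ?enum_uniq // => i.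
  rewrite mem_enum; apply/mapP; exists (w i); rewrite ?mem_enum //.
  by rewrite permK.
have [l1 [l2 E]] := pick_split pl sz; exists l1, l2 => x; rewrite -E.
by rewrite /permuted /l -map_comp.
Qed.

Lemma Sh_multilinear p q F s1 c x y s2 : multilinear F ->
  (size s1 + (size s2).+1 = p + q)%N ->
  Sh p q F (s1 ++ (c *: x + y) :: s2) =
  c *: Sh p q F (s1 ++ x :: s2) + Sh p q F (s1 ++ y :: s2).
Proof.
move=> Fm sz; rewrite /Sh scaler_sumr -big_split; apply: eq_bigr => w _ /=.
have [l1 [l2 E]] := permuted_split w sz.
by rewrite !E Fm scalerDr !scalerA mulrC.
Qed.

Lemma Sh_comb p q c F G z :
  Sh p q (fun s => c *: F s + G s) z = c *: Sh p q F z + Sh p q G z.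
Proof.
rewrite /Sh scaler_sumr -big_split; apply: eq_bigr => w _ /=.
by rewrite scalerDr !scalerA mulrC.
Qed.

Lemma eq_Sh p q F G z : F =1 G -> Sh p q F z = Sh p q G z.
Proof. by move=> FG; apply: eq_bigr => w _; rewrite FG. Qed.

End Shuffles.

Lemma Sh_normalized (k : comNzRingType) (A : kalgType k) (P : lmodType k)
    (p q : nat) (F : seq A -> P) s1 s2 : normalized F ->
  (size s1 + (size s2).+1 = p + q)%N -> Sh p q F (s1 ++ kone :: s2) = 0.
Proof.
move=> Fn sz; rewrite /Sh big1 // => w _.
by have [l1 [l2 ->]] := permuted_split w sz; rewrite Fn scaler0.
Qed.

Section OmegaTensor.
Variables (k : comNzRingType) (A B : kalgType k) (P : lmodType k).

Definition olift2 (F : A -> seq A -> B -> seq B -> P) : tens (Omega A) (Omega B) -> P :=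
  tlift (fun x y => olift (fun a0 s => olift (fun b0 t => F a0 s b0 t) y) x).

Section Lift2.
Variable F : A -> seq A -> B -> seq B -> P.
Hypothesis Fl : forall b0 t, form_map (fun a0 s => F a0 s b0 t).
Hypothesis Fr : forall a0 s, form_map (F a0 s).

Lemma olift2_in y : form_map (fun a0 s => olift (fun b0 t => F a0 s b0 t) y).
Proof.
split=> [s c u v|a0 s1 c u v s2|a0 s1 s2].
- rewrite -olift_comb; apply: eq_olift => b0 t.
  by case: (Fl b0 t) => F0 _ _; rewrite F0.
- rewrite -olift_comb; apply: eq_olift => b0 t.
  by case: (Fl b0 t) => _ FS _; rewrite FS.
rewrite -[RHS](olift0 _ y); apply: eq_olift => b0 t.
by case: (Fl b0 t) => _ _ Fn; rewrite Fn.
Qed.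

Lemma olift2_bilin :
  bilin (fun x y => olift (fun a0 s => olift (fun b0 t => F a0 s b0 t) y) x).
Proof.
split=> [y|x] c u v; first exact: olift_linear (olift2_in y) _ _ _.
rewrite -olift_comb; apply: eq_olift => a0 s.
exact: olift_linear (Fr a0 s) _ _ _.
Qed.

Lemma olift2_linear : linear (olift2 F).
Proof. exact: tlift_linear olift2_bilin. Qed.

Lemma olift2E a0 s b0 t : olift2 F (form a0 s ⊗ form b0 t) = F a0 s b0 t.
Proof.
rewrite /olift2 (tlift_pure olift2_bilin) (oliftE (olift2_in _)).
exact: oliftE.
Qed.
End Lift2.
End OmegaTensor.

Section ShMap.
Variables (k : comNzRingType) (A B : kalgType k).
Notation T := (tens A B).

Definition inA (a : A) : T := a ⊗ kone.
Definition inB (b : B) : T := kone ⊗ b.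

Lemma inA_linear : linear inA.
Proof. by have [bl _] := tpure_bilin A B; apply: bl. Qed.
Lemma inB_linear : linear inB.
Proof. by have [_ br] := tpure_bilin A B; apply: br. Qed.

Definition sh_word (a0 : A) (s : seq A) (b0 : B) (t : seq B) : Omega T :=
  Sh (size s) (size t) (form (a0 ⊗ b0)) (map inA s ++ map inB t).

Definition sh : tens (Omega A) (Omega B) -> Omega T := olift2 sh_word.

Lemma sh_word_l b0 t : form_map (fun a0 s => sh_word a0 s b0 t).
Proof.
have [bl br] := tpure_bilin A B.
split=> [s c x y|a0 s1 c x y s2|a0 s1 s2]; rewrite /sh_word.
- by rewrite -Sh_comb; apply: eq_Sh => z; rewrite bl formDl.
- rewrite !map_cat -!catA /= inA_linear !size_cat /=.
  apply: Sh_multilinear; first exact: form_multilinear.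
  by rewrite size_cat !size_map -addSn addnA.
rewrite map_cat -catA /= size_cat /=; apply: Sh_normalized.
  exact: form_normalized.
by rewrite size_cat !size_map -addSn addnA.
Qed.

Lemma sh_word_r a0 s : form_map (sh_word a0 s).
Proof.
have [bl br] := tpure_bilin A B.
split=> [t c x y|b0 s1 c x y s2|b0 s1 s2]; rewrite /sh_word.
- by rewrite -Sh_comb; apply: eq_Sh => z; rewrite br formDl.
- rewrite !map_cat !catA /= inB_linear !size_cat /=.
  apply: Sh_multilinear; first exact: form_multilinear.
  by rewrite size_cat !size_map addnA.
rewrite map_cat catA /= size_cat /=; apply: Sh_normalized.
  exact: form_normalized.
by rewrite size_cat !size_map addnA.
Qed.

Lemma sh_linear : linear sh.
Proof. exact: olift2_linear sh_word_l sh_word_r. Qed.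

Lemma shE a0 s b0 t :
  sh (form a0 s ⊗ form b0 t) =
  Sh (size s) (size t) (form (a0 ⊗ b0)) (map inA s ++ map inB t).
Proof. exact: olift2E sh_word_l sh_word_r _ _ _ _. Qed.

End ShMap.
Arguments inA {k A} B a.
Arguments inB {k} A {B} b.

Section Expand.
Variables (k : comNzRingType) (A B : kalgType k) (P : lmodType k).
Notation T := (tens A B).

(* The multilinear extension to lists of tensors of a function F of lists of pure
   tensors, see tens_expandE. *)
Fixpoint tens_expand (F : seq (A * B) -> P) (ts : seq T) : P :=
  if ts is t :: ts' then
    tlift (fun (a : A) (b : B) => tens_expand (fun l => F ((a, b) :: l)) ts') t
  else F [::].

Lemma eq_tens_expand F G ts :
  (forall l, size l = size ts -> F l = G l) -> tens_expand F ts = tens_expand G ts.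
Proof.
elim: ts F G => [|t ts IHt] F G FG /=; first exact: FG.
by apply: eq_tlift => a b; apply: IHt => l sz; apply: FG; rewrite /= sz.
Qed.

Lemma tens_expand_comb c F G ts :
  tens_expand (fun l => c *: F l + G l) ts = c *: tens_expand F ts + tens_expand G ts.
Proof.
elim: ts F G => [|t ts IHt] F G //=; rewrite -tlift_comb.
by apply: eq_tlift => a b; rewrite IHt.
Qed.

Lemma tens_expand0 ts : tens_expand (fun=> 0) ts = 0.
Proof.
by elim: ts => //= t ts IHt; rewrite -[RHS](tlift0 _ t); apply: eq_tlift.
Qed.

Definition multibilinear n (F : seq (A * B) -> P) : Prop :=
  forall l1 l2 : seq (A * B), (size l1 + (size l2).+1 = n)%N ->
  bilin (fun (a : A) (b : B) => F (l1 ++ (a, b) :: l2)).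

Lemma multibilinear_cons n F x :
  multibilinear n.+1 F -> multibilinear n (fun l => F (x :: l)).
Proof. by move=> Fm l1 l2 sz; apply: (Fm (x :: l1)); rewrite /= addSn sz. Qed.

Lemma tens_expand_bilin n F ts : multibilinear n F -> (size ts).+1 = n ->
  bilin (fun (a : A) (b : B) => tens_expand (fun l => F ((a, b) :: l)) ts).
Proof.
move=> Fm sz; split=> [b|a] c x y; rewrite -tens_expand_comb;
  apply: eq_tens_expand => l szl.
  by have [|bl _] := Fm [::] l; [rewrite /= add0n szl | apply: bl].
by have [|_ br] := Fm [::] l; [rewrite /= add0n szl | apply: br].
Qed.

Lemma tens_expandE n F l : multibilinear n F -> size l = n ->
  tens_expand F [seq x.1 ⊗ x.2 | x <- l] = F l.
Proof.
elim: l n F => [|[a b] l IHl] n F Fm //= sz.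
have sz' : (size [seq x.1 ⊗ x.2 | x <- l]).+1 = n by rewrite size_map.
rewrite (tlift_pure (tens_expand_bilin Fm sz')); rewrite -sz in Fm.
exact: (IHl (size l) (fun l => F ((a, b) :: l)) (multibilinear_cons (a, b) Fm) erefl).
Qed.

Lemma tens_expand_multilinear n F s1 c x y s2 : multibilinear n F ->
  (size s1 + (size s2).+1 = n)%N ->
  tens_expand F (s1 ++ (c *: x + y) :: s2) =
  c *: tens_expand F (s1 ++ x :: s2) + tens_expand F (s1 ++ y :: s2).
Proof.
elim: s1 n F => [|t s1 IHs] n F Fm /= sz.
  exact: tlift_linear (tens_expand_bilin Fm _) _ _ _.
rewrite -tlift_comb; apply: eq_tlift => a b.
rewrite -sz addSn in Fm.
exact: (IHs _ (fun l => F ((a, b) :: l)) (multibilinear_cons (a, b) Fm) erefl).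
Qed.

Lemma tens_expand_normalized n F s1 s2 : multibilinear n F ->
  (forall l1 l2, (size l1 + (size l2).+1 = n)%N -> F (l1 ++ (kone, kone) :: l2) = 0) ->
  (size s1 + (size s2).+1 = n)%N -> tens_expand F (s1 ++ kone :: s2) = 0.
Proof.
elim: s1 n F => [|t s1 IHs] n F Fm F1 /= sz.
  rewrite (tlift_pure (tens_expand_bilin Fm sz)) -[RHS](tens_expand0 s2).
  by apply: eq_tens_expand => l szl; rewrite (F1 [::]) // szl.
rewrite -[RHS](tlift0 _ t); apply: eq_tlift => a b.
rewrite -sz addSn in Fm F1.
apply: (IHs _ (fun l => F ((a, b) :: l)) (multibilinear_cons (a, b) Fm) _ erefl) => l1 l2 szl.
by rewrite -cat_cons F1 //= addSn szl.
Qed.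
End Expand.

Section Phi.
Variables (k : comNzRingType) (A B : kalgType k).
Notation T := (tens A B).

Definition kprod (C : kalgType k) (s : seq C) : C := foldr kmul kone s.

Lemma kprod_linear (C : kalgType k) (s1 s2 : seq C) :
  linear (fun x => kprod (s1 ++ x :: s2)).
Proof.
elim: s1 => [|y s1 IHs] c u v; first exact: kmul_linearl.
by rewrite /kprod /= -/(kprod _) IHs kmul_linearr.
Qed.

(* phi^{r,p} on w d(a_1 (x) b_1) ... d(a_r (x) b_r), where w = t0 du and
   l = [:: (a_1, b_1); ...; (a_r, b_r)]. *)
Definition phi_pure (p : nat) (t0 : T) (u : seq T) (l : seq (A * B)) : Omega T :=
  Sh p (size l - p)
    (fun z => form (inA B (kprod (drop p (unzip1 l))) ∙ t0)
                   (u ++ inB A (kprod (take p (unzip2 l))) :: z))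
    (map (inA B) (take p (unzip1 l)) ++ map (inB A) (drop p (unzip2 l))).

Definition phi_word_rp (r p : nat) (t0 : T) (ts : seq T) : Omega T :=
  tens_expand (phi_pure p t0 (take (size ts - r) ts)) (drop (size ts - r) ts).

Definition phi_word (t0 : T) (ts : seq T) : Omega T :=
  \sum_(r < (size ts).+1) \sum_(p < r.+1 | (0 < p)%N)
    (-1) ^+ (size ts + r) *: phi_word_rp r p t0 ts.

Definition phi : Omega T -> Omega T := olift phi_word.

Lemma takeC (S : Type) p p' (l1 l2 : seq S) x : (p = size l1 + p'.+1)%N ->
  take p (l1 ++ x :: l2) = l1 ++ x :: take p' l2.
Proof. by move=> ->; rewrite take_cat ltnNge leq_addr /= addKn. Qed.

Lemma dropC (S : Type) p p' (l1 l2 : seq S) x : (p = size l1 + p'.+1)%N ->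
  drop p (l1 ++ x :: l2) = drop p' l2.
Proof. by move=> ->; rewrite drop_cat ltnNge leq_addr /= addKn. Qed.

Lemma drop_catl (S : Type) p (l1 l2 : seq S) : (p <= size l1)%N ->
  drop p (l1 ++ l2) = drop p l1 ++ l2.
Proof.
by rewrite drop_cat; case: ltngtP => // -> _; rewrite subnn drop0 drop_size.
Qed.

Lemma form_tail_multilinear (C : kalgType k) (c0 : C) u x :
  multilinear (fun z => form c0 (u ++ x :: z)).
Proof.
move=> s1 c y z s2.
by have := @form_multilinear _ C c0 (u ++ x :: s1) c y z s2; rewrite -!catA.
Qed.

Lemma form_tail_normalized (C : kalgType k) (c0 : C) u x :
  normalized (fun z => form c0 (u ++ x :: z)).
Proof.
move=> s1 s2.
by have := @form_normalized _ C c0 (u ++ x :: s1) s2; rewrite -!catA.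
Qed.

Lemma phi_pure_multibilinear p r t0 u : (p <= r)%N ->
  multibilinear r (phi_pure p t0 u).
Proof.
move=> le_pr l1 l2 sz; rewrite /phi_pure.
have szl (a : A) (b : B) : size (l1 ++ (a, b) :: l2) = r by rewrite size_cat.
have u1 (a : A) (b : B) : unzip1 (l1 ++ (a, b) :: l2) = unzip1 l1 ++ a :: unzip1 l2.
  exact: map_cat.
have u2 (a : A) (b : B) : unzip2 (l1 ++ (a, b) :: l2) = unzip2 l1 ++ b :: unzip2 l2.
  exact: map_cat.
case: (leqP p (size l1)) => [le_p|lt_p]; last first.
  have [p' p'E] : exists p', p = (size l1 + p'.+1)%N.
    by exists (p - size l1).-1; lia.
  have p1 : p = (size (unzip1 l1) + p'.+1)%N by rewrite size_map.
  have p2 : p = (size (unzip2 l1) + p'.+1)%N by rewrite size_map.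
  split=> [b|a] c x y; rewrite !szl !u1 !u2 !(takeC _ _ p1) !(takeC _ _ p2)
    !(dropC _ _ p1) !(dropC _ _ p2).
    rewrite !map_cat /= inA_linear -!catA /=; apply: Sh_multilinear.
      exact: form_tail_multilinear.
    by rewrite !size_cat !size_map size_take size_drop !size_map; case: ltnP; lia.
  rewrite -Sh_comb; apply: eq_Sh => z.
  by rewrite kprod_linear inB_linear form_multilinear.
have le1 : (p <= size (unzip1 l1))%N by rewrite size_map.
have le2 : (p <= size (unzip2 l1))%N by rewrite size_map.
split=> [b|a] c x y; rewrite !szl !u1 !u2 !(takel_cat _ le1) !(takel_cat _ le2)
    !(drop_catl _ le1) !(drop_catl _ le2).
  rewrite -Sh_comb; apply: eq_Sh => z.
  by rewrite kprod_linear inA_linear kmul_linearl formDl.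
rewrite !map_cat /= inB_linear !catA; apply: Sh_multilinear.
  exact: form_tail_multilinear.
by rewrite !size_cat !size_map size_take size_drop !size_map; case: ltnP; lia.
Qed.

Lemma phi_pure_normalized p r t0 u l1 l2 : (p <= r)%N ->
  (size l1 + (size l2).+1 = r)%N ->
  phi_pure p t0 u (l1 ++ (kone, kone) :: l2) = 0.
Proof.
move=> le_pr sz; rewrite /phi_pure size_cat /= sz.
have -> : unzip1 (l1 ++ (kone, kone) :: l2) = unzip1 l1 ++ kone :: unzip1 l2.
  exact: map_cat.
have -> : unzip2 (l1 ++ (kone, kone) :: l2) = unzip2 l1 ++ kone :: unzip2 l2.
  exact: map_cat.
case: (leqP p (size l1)) => [le_p|lt_p]; last first.
  have [p' p'E] : exists p', p = (size l1 + p'.+1)%N.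
    by exists (p - size l1).-1; lia.
  have p1 : p = (size (unzip1 l1) + p'.+1)%N by rewrite size_map.
  have p2 : p = (size (unzip2 l1) + p'.+1)%N by rewrite size_map.
  rewrite !(takeC _ _ p1) !(dropC _ _ p2) !map_cat /= -!catA /=.
  apply: Sh_normalized; first exact: form_tail_normalized.
  by rewrite !size_cat !size_map size_take size_drop !size_map; case: ltnP; lia.
have le1 : (p <= size (unzip1 l1))%N by rewrite size_map.
have le2 : (p <= size (unzip2 l1))%N by rewrite size_map.
rewrite !(takel_cat _ le1) !(drop_catl _ le2) !map_cat /= !catA.
apply: Sh_normalized; first exact: form_tail_normalized.
by rewrite !size_cat !size_map size_take size_drop !size_map; case: ltnP; lia.
Qed.

Lemma phi_pure_linear0 p u l : linear (fun t0 => phi_pure p t0 u l).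
Proof.
move=> c x y; rewrite -Sh_comb; apply: eq_Sh => z.
by rewrite kmul_linearr formDl.
Qed.

Lemma phi_pure_linearS p t0 l z s1 c x y s2 : z = s1 ++ (c *: x + y) :: s2 ->
  phi_pure p t0 z l =
  c *: phi_pure p t0 (s1 ++ x :: s2) l + phi_pure p t0 (s1 ++ y :: s2) l.
Proof.
move=> ->; rewrite -Sh_comb; apply: eq_Sh => v.
by rewrite -!catA form_multilinear.
Qed.

Lemma phi_pure_normalS p t0 l s1 s2 :
  phi_pure p t0 (s1 ++ kone :: s2) l = 0.
Proof.
rewrite /phi_pure /Sh big1 // => w _.
by rewrite -catA form_normalized scaler0.
Qed.

Lemma phi_word_rp_form_map n r p : (p <= r)%N -> (r <= n)%N ->
  [/\ forall ts, linear (fun t0 => phi_word_rp r p t0 ts),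
      forall t0 s1 c x y s2, (size s1 + (size s2).+1 = n)%N ->
        phi_word_rp r p t0 (s1 ++ (c *: x + y) :: s2) =
        c *: phi_word_rp r p t0 (s1 ++ x :: s2) + phi_word_rp r p t0 (s1 ++ y :: s2)
    & forall t0 s1 s2, (size s1 + (size s2).+1 = n)%N ->
        phi_word_rp r p t0 (s1 ++ kone :: s2) = 0].
Proof.
move=> le_pr le_rn; split=> [ts c x y|t0 s1 c x y s2 sz|t0 s1 s2 sz].
- rewrite -tens_expand_comb; apply: eq_tens_expand => l _.
  exact: phi_pure_linear0.
- rewrite /phi_word_rp !size_cat /= sz.
  case: (leqP (n - r) (size s1)) => [le1|lt1].
    rewrite !(takel_cat _ le1) !(drop_catl _ le1).
    apply: (@tens_expand_multilinear _ _ _ _ r).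
      exact: phi_pure_multibilinear.
    by rewrite size_drop; lia.
  have [m' mE] : exists m', (n - r)%N = (size s1 + m'.+1)%N.
    by exists ((n - r) - size s1).-1; lia.
  rewrite !(takeC _ _ mE) !(dropC _ _ mE) -tens_expand_comb.
  by apply: eq_tens_expand => l _; apply: phi_pure_linearS.
rewrite /phi_word_rp !size_cat /= sz.
case: (leqP (n - r) (size s1)) => [le1|lt1].
  rewrite !(takel_cat _ le1) !(drop_catl _ le1).
  apply: (@tens_expand_normalized _ _ _ _ r).
  - exact: phi_pure_multibilinear.
  - by move=> l1 l2; apply: phi_pure_normalized.
  by rewrite size_drop; lia.
have [m' mE] : exists m', (n - r)%N = (size s1 + m'.+1)%N.
  by exists ((n - r) - size s1).-1; lia.
rewrite !(takeC _ _ mE) !(dropC _ _ mE) -[RHS](@tens_expand0 _ A B _ (drop m' s2)).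
by apply: eq_tens_expand => l _; apply: phi_pure_normalS.
Qed.

Lemma phi_form_map : form_map phi_word.
Proof.
have ok n (r : 'I_n.+1) (p : 'I_r.+1) :=
  phi_word_rp_form_map (ltnSE (ltn_ord p)) (ltnSE (ltn_ord r)).
split=> [ts c x y|t0 s1 c x y s2|t0 s1 s2]; rewrite /phi_word.
- rewrite scaler_sumr -big_split; apply: eq_bigr => r _ /=.
  rewrite scaler_sumr -big_split; apply: eq_bigr => p _ /=.
  case: (ok _ r p) => -> _ _.
  by rewrite scalerDr !scalerA [c * _]mulrC.
- rewrite !size_cat /= scaler_sumr -big_split; apply: eq_bigr => r _ /=.
  rewrite scaler_sumr -big_split; apply: eq_bigr => p _ /=.
  case: (ok _ r p) => _ -> // _.
  by rewrite scalerDr !scalerA [c * _]mulrC.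
rewrite !size_cat /= big1 // => r _; rewrite big1 // => p _.
by case: (ok _ r p) => _ _ -> //; rewrite scaler0.
Qed.

Lemma phi_linear : linear phi.
Proof. exact: olift_linear phi_form_map. Qed.

Lemma phiE t0 ts : phi (form t0 ts) = phi_word t0 ts.
Proof. exact: oliftE phi_form_map _ _. Qed.

Lemma phi_word_rpE r p t0 u (l : seq (A * B)) : (p <= r)%N -> size l = r ->
  phi_word_rp r p t0 (u ++ [seq x.1 ⊗ x.2 | x <- l]) =
  Sh p (r - p)
    (fun z => form ((kprod (drop p (unzip1 l)) ⊗ kone) ∙ t0)
                   (u ++ (kone ⊗ kprod (take p (unzip2 l))) :: z))
    ([seq a ⊗ kone | a <- take p (unzip1 l)] ++
     [seq kone ⊗ b | b <- drop p (unzip2 l)]).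
Proof.
move=> le_pr sz; rewrite /phi_word_rp size_cat size_map sz addnK.
rewrite take_size_cat // drop_size_cat //.
by rewrite (tens_expandE (phi_pure_multibilinear _ _ le_pr)) // /phi_pure sz.
Qed.

End Phi.

Section Functoriality.
Variables (k : comNzRingType) (A B : kalgType k).

Definition Omap (f : A -> B) : Omega A -> Omega B :=
  olift (fun a0 s => form (f a0) (map f s)).

Lemma Omap_form_map (f : A -> B) : linear f -> f kone = kone ->
  form_map (fun a0 s => form (f a0) (map f s)).
Proof.
move=> fl f1; split=> [s c x y|a0 s1 c x y s2|a0 s1 s2].
- by rewrite fl formDl.
- by rewrite !map_cat /= fl form_multilinear.
by rewrite map_cat /= f1 form_normalized.
Qed.

Lemma OmapE (f : A -> B) a0 s : linear f -> f kone = kone ->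
  Omap f (form a0 s) = form (f a0) (map f s).
Proof. by move=> fl f1; apply: (oliftE (Omap_form_map fl f1)). Qed.

Lemma Omap_linear (f : A -> B) : linear f -> f kone = kone -> linear (Omap f).
Proof. by move=> fl f1; apply: olift_linear (Omap_form_map fl f1). Qed.

Lemma tswap_bilin : bilin (fun (a : A) (b : B) => b ⊗ a).
Proof. by have [bl br] := tpure_bilin B A; split. Qed.

Lemma tswapE a b : @tswap _ A B (a ⊗ b) = b ⊗ a.
Proof. exact: tlift_pure tswap_bilin _ _. Qed.

Lemma tswap_linear : linear (@tswap _ A B).
Proof. exact: tlift_linear tswap_bilin. Qed.

End Functoriality.

Section Flip.
Variables (k : comNzRingType) (A B : kalgType k).

Definition flip_word (a0 : A) (s : seq A) (b0 : B) (t : seq B) :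
    tens (Omega B) (Omega A) :=
  (-1) ^+ (size s * size t) *: (form b0 t ⊗ form a0 s).

Definition flip : tens (Omega A) (Omega B) -> tens (Omega B) (Omega A) :=
  olift2 flip_word.

Lemma flip_word_l b0 t : form_map (fun a0 s => flip_word a0 s b0 t).
Proof.
have [_ br] := tpure_bilin (Omega B) (Omega A).
apply: (@form_map_size _ _ _ (fun n a0 s =>
  (-1) ^+ (n * size t) *: (form b0 t ⊗ form a0 s))) => n.
apply: form_map_scale; split=> [s c x y|a0 s1 c x y s2|a0 s1 s2].
- by rewrite formDl br.
- by rewrite form_multilinear br.
by rewrite form_normalized (linear_at0 (br _)).
Qed.

Lemma flip_word_r a0 s : form_map (flip_word a0 s).
Proof.
have [bl _] := tpure_bilin (Omega B) (Omega A).
apply: (@form_map_size _ _ _ (fun n b0 t =>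
  (-1) ^+ (size s * n) *: (form b0 t ⊗ form a0 s))) => n.
apply: form_map_scale; split=> [t c x y|b0 s1 c x y s2|b0 s1 s2].
- by rewrite formDl bl.
- by rewrite form_multilinear bl.
by rewrite form_normalized (linear_at0 (bl _)).
Qed.

Lemma flipE a0 s b0 t : flip (form a0 s ⊗ form b0 t) =
  (-1) ^+ (size s * size t) *: (form b0 t ⊗ form a0 s).
Proof. exact: olift2E flip_word_l flip_word_r _ _ _ _. Qed.

Lemma flip_linear : linear flip.
Proof. exact: olift2_linear flip_word_l flip_word_r. Qed.

(* x (x) y |-> f x (x) y + (-1)^|x| x (x) g y *)
Definition tens_op (f : Omega A -> Omega A) (g : Omega B -> Omega B) :
    tens (Omega A) (Omega B) -> tens (Omega A) (Omega B) :=
  tlift (fun (x : Omega A) (y : Omega B) => f x ⊗ y + omega_sign x ⊗ g y).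

Lemma tens_op_bilin (f : Omega A -> Omega A) (g : Omega B -> Omega B) :
  linear f -> linear g ->
  bilin (fun (x : Omega A) (y : Omega B) => f x ⊗ y + omega_sign x ⊗ g y).
Proof.
have [bl br] := tpure_bilin (Omega A) (Omega B).
move=> fl gl; split=> [y|x] c u v.
  by rewrite fl omega_sign_linear !bl scalerDr addrACA.
by rewrite gl !br scalerDr addrACA.
Qed.

Lemma tens_opE (f : Omega A -> Omega A) (g : Omega B -> Omega B) x y :
  linear f -> linear g ->
  tens_op f g (x ⊗ y) = f x ⊗ y + omega_sign x ⊗ g y.
Proof. by move=> fl gl; apply: (tlift_pure (tens_op_bilin fl gl)). Qed.

Lemma tens_op_linear (f : Omega A -> Omega A) (g : Omega B -> Omega B) :
  linear f -> linear g -> linear (tens_op f g).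
Proof. by move=> fl gl; apply: (tlift_linear (tens_op_bilin fl gl)). Qed.

Definition tens_b := tens_op (@hochschild_b _ A) (@hochschild_b _ B).
Definition tens_B := tens_op (@connes_B _ A) (@connes_B _ B).

Definition tens_deg (n : nat) (z : tens (Omega A) (Omega B)) : Prop :=
  exists2 l : seq (Omega A * Omega B),
    (forall x, x \in l -> exists p q,
       [/\ (p + q)%N = n, Omega_deg p x.1 & Omega_deg q x.2]) &
    z = \sum_(x <- l) x.1 ⊗ x.2.

End Flip.

(* A map between completed graded modules that is a sum over i >= 0 of components of
   degree s + 2 i, for a fixed s, is represented by the sequence of its components.
   Composition is then the Cauchy product.  For b + B the offset s is -1. *)
Section Series.
Variables (k : comNzRingType).

Definition ser_comp (U V W : lmodType k) (F : nat -> V -> W) (G : nat -> U -> V)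
    (i : nat) (x : U) : W :=
  \sum_(j < i.+1) F j (G (i - j)%N x).

Definition ser_bB (U : lmodType k) (b B : U -> U) (i : nat) : U -> U :=
  match i with 0 => b | 1 => B | _ => fun=> 0 end.

Variables A B : kalgType k.

Definition bB_tens : nat -> tens (Omega A) (Omega B) -> tens (Omega A) (Omega B) :=
  ser_bB (@tens_b k A B) (@tens_B k A B).

Definition bB_Omega (C : kalgType k) : nat -> Omega C -> Omega C :=
  ser_bB (@hochschild_b k C) (@connes_B k C).

(* The component (phi B)^m phi of phi_oo; here s = 1. *)
Definition phi_inf (m : nat) (w : Omega (tens A B)) : Omega (tens A B) :=
  iter m (fun v => phi (connes_B v)) (phi w).

(* (1 + phi_oo B) sh, with s = 0. *)
Definition sh_inf (i : nat) (z : tens (Omega A) (Omega B)) : Omega (tens A B) :=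
  if i is m.+1 then phi_inf m (connes_B (sh z)) else sh z.

End Series.

Arguments bB_tens {k} A B.
Arguments bB_Omega {k} C.

(* sigma sh_oo sigma, where flip and Omap tswap are the two maps called sigma. *)
Definition sigma_sh_inf (k : comNzRingType) (A B : kalgType k) (i : nat)
    (z : tens (Omega A) (Omega B)) : Omega (tens A B) :=
  Omap (@tswap k B A) (sh_inf i (flip z)).

(* Main.v *)
From HB Require Import structures.
Require Import Defs.
From mathcomp Require Import all_boot all_algebra.
From mathcomp Require Import all_fingroup zify ring.
Import Defs.
Set Implicit Arguments.
Unset Strict Implicit.
Unset Printing Implicit Defensive.
Import GRing.Theory.
Local Open Scope ring_scope.

(** Write h0 and h1 for the first two components of a natural homotopy h, and
let D = k[x]/(x^2).  In the lowest degrees the homotopy equation says that h0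
anticommutes with b, because the two coextensions have the same component
sh in bidegrees of total degree at most 1, and, on x (x) y in D (x) D,
with y the generator of the second factor, that
<<
  dx dy - dy dx = b h1(x (x) y) + B h0(x (x) y) + h0(dx (x) y) + h0(x (x) dy).
>>
The cup product of the derivations d/dx and d/dy, which sends t0 dt1 dt2 to
t0(0) (d/dx t1)(0) (d/dy t2)(0), is a Hochschild cocycle: it kills b h1(x (x) y)
([cup_b]), and it takes the value 1 on the left hand side.  So it suffices
that it vanishes on the other three terms.  This cannot be read off from Kähler
differentials, where the left hand side becomes 2 dx dy and is lost in
characteristic 2.

Contracting a form on A (x) D with d/dy in its last entry is a chain map to
Omega A in low degrees, so w |-> contraction of h0(w (x) y) is a natural
endomorphism N of Omega A that anticommutes with b.  Contracting in
the first entry gives in the same way a natural endomorphism N' of Omega B,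
w |-> contraction of h0(x (x) w), that commutes with b.  The cup product is a
contraction followed by the functional tau : a0 da1 |-> a0(0) a1'(0), and its
composite with B is the difference of the coefficients of x in the two
contractions ([cup_connes]).  With c and c' the coefficients of x in N(x) and
N'(x), the three terms are therefore c - c', tau(N(dx)) and tau(N'(dx)).

The heart of the proof is [natural_endo_slope]: if a natural endomorphism N
satisfies b N = s N b, then tau(N(dx)) = s c.  Hence the three terms are c - c',
- c and c', which add up to 0, and 1 = 0 in k.  For that lemma, let u and v be
noncommuting variables with u^2, v^2 and all words of length 3 equal to zero.  The
coefficient of uv in b N(u dv) = s N([u, v]) is s c, because x |-> [u, v] induces
a map out of D.  It is also the difference between two values of one functional: on N(u dv), and on
its image under the exchange of u and v.  It remains to identify these
with tau(N(dx)) and 0 = tau(N(x d1)), that is, to replace u by 1.  Comparing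
degrees in u does not achieve this, since over a field of characteristic p the map
u |-> u^p is additive on commutative algebras.  Instead u is realised as the
matrix unit e12, which is the difference of the two conjugate idempotents
e11 + e12 and e11; the functional changes under the conjugation by the
difference of its values at the two diagonal entries 1 and 0 of e11
([corner_shear]). *)

(** * Linear maps, algebra morphisms and degrees *)

Section LinearProp.
Variables (k : comNzRingType) (U V W : lmodType k).
Implicit Types (f : U -> V) (g : V -> W).

Lemma linear_add f : linear f -> forall x y, f (x + y) = f x + f y.
Proof. by move=> fl x y; have := fl 1 x y; rewrite !scale1r. Qed.

Lemma linear_scale f : linear f -> forall c x, f (c *: x) = c *: f x.
Proof. by move=> fl c x; have := fl c x 0; rewrite (linear_at0 fl) !addr0. Qed.

Lemma linear_sub f : linear f -> forall x y, f (x - y) = f x - f y.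
Proof.
by move=> fl x y; rewrite (linear_add fl) -scaleN1r (linear_scale fl) scaleN1r.
Qed.

Lemma linear_opp f : linear f -> forall x, f (- x) = - f x.
Proof. by move=> fl x; rewrite -scaleN1r (linear_scale fl) scaleN1r. Qed.

Lemma linear_bigsum f : linear f -> forall (I : Type) (r : seq I) (F : I -> U),
  f (\sum_(i <- r) F i) = \sum_(i <- r) f (F i).
Proof.
move=> fl I r F; elim: r => [|i r IHr]; first by rewrite !big_nil (linear_at0 fl).
by rewrite !big_cons (linear_add fl) IHr.
Qed.

Lemma linear_compose f g : linear f -> linear g -> linear (fun x => g (f x)).
Proof. by move=> fl gl c x y; rewrite fl gl. Qed.

End LinearProp.

Section KmulLinear.
Variables (k : comNzRingType) (A : kalgType k).
Implicit Types x y z : A.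

Lemma kmulDl x y z : (x + y) ∙ z = x ∙ z + y ∙ z.
Proof. exact: (linear_add (kmul_linearl z)). Qed.
Lemma kmulDr x y z : x ∙ (y + z) = x ∙ y + x ∙ z.
Proof. exact: (linear_add (kmul_linearr x)). Qed.
Lemma kmul0x x : 0 ∙ x = 0.
Proof. exact: (linear_at0 (kmul_linearl x)). Qed.
Lemma kmulx0 x : x ∙ 0 = 0.
Proof. exact: (linear_at0 (kmul_linearr x)). Qed.
End KmulLinear.

Lemma id_morphism (k : comNzRingType) (A : kalgType k) : kalg_morphism (fun a : A => a).
Proof. by []. Qed.

Lemma tmap_kalg_morphism (k : comNzRingType) (A A' B B' : kalgType k)
    (f : A -> A') (g : B -> B') :
  kalg_morphism f -> kalg_morphism g -> kalg_morphism (tmap f g).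
Proof.
move=> [fl f1 fM] [gl g1 gM]; have lin := tmap_linear fl gl; split => //.
  by rewrite tmapE // f1 g1.
move=> s t; move: s; apply: tens_eq => [c x y|c x y|a b].
- by rewrite kmul_linearl lin.
- by rewrite lin kmul_linearl.
move: t; apply: tens_eq => [c x y|c x y|a' b'].
- by rewrite kmul_linearr lin.
- by rewrite lin kmul_linearr.
by rewrite tensM !tmapE // fM gM tensM.
Qed.

Section Degrees.
Variables (k : comNzRingType) (A : kalgType k).

Lemma Omega_deg_form (a : A) s : Omega_deg (size s) (form a s).
Proof. by exists [:: (a, s)]; rewrite ?big_seq1 //= eqxx. Qed.

Lemma Omega_deg_eq n (P : lmodType k) (f g : Omega A -> P) :
  linear f -> linear g ->
  (forall a s, size s = n -> f (form a s) = g (form a s)) ->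
  forall w, Omega_deg n w -> f w = g w.
Proof.
move=> fl gl fg w [l /allP szl ->].
rewrite !(linear_bigsum _) //; apply: eq_big_seq => -[a s] /szl /= /eqP.
exact: fg.
Qed.

Lemma Omega_deg_map n m (C : kalgType k) (f : Omega A -> Omega C) :
  linear f -> (forall a s, size s = n -> Omega_deg m (f (form a s))) ->
  forall w, Omega_deg n w -> Omega_deg m (f w).
Proof.
move=> fl fd w [l + ->]; rewrite (linear_bigsum fl).
elim: l => [|[a s] l IHl] /=; first by exists [::]; rewrite ?big_nil.
move=> /andP[/eqP szs /IHl[l2 sz2 E2]]; have [l1 sz1 E1] := fd a s szs.
by exists (l1 ++ l2); rewrite ?all_cat ?sz1 // big_cons big_cat /= E1 E2.
Qed.

End Degrees.

(** * The operators b and B, and shuffles, in low degrees *)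

Section LowDegrees.
Variables (k : comNzRingType) (A : kalgType k).
Implicit Types a : A.

Lemma hochschild_b0 a : hochschild_b (form a [::]) = 0.
Proof. by rewrite hochschild_bE. Qed.

Lemma hochschild_b1 a0 a1 :
  hochschild_b (form a0 [:: a1]) = form (a0 ∙ a1) [::] - form (a1 ∙ a0) [::].
Proof. by rewrite hochschild_bE /hochschild_word /= ractE lactE scale1r. Qed.

Lemma hochschild_b2 a0 a1 a2 :
  hochschild_b (form a0 [:: a1; a2]) =
  form (a0 ∙ a1) [:: a2] - form a0 [:: a1 ∙ a2] + form (a2 ∙ a0) [:: a1].
Proof.
rewrite hochschild_bE /hochschild_word /= ractE lactE /= dappE /=.
by rewrite expr1 scaleN1r !opprB addrC.
Qed.

Lemma hochschild_b3 a0 a1 a2 a3 :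
  hochschild_b (form a0 [:: a1; a2; a3]) =
  form (a0 ∙ a1) [:: a2; a3] - form a0 [:: a1 ∙ a2; a3]
  + form a0 [:: a1; a2 ∙ a3] - form (a3 ∙ a0) [:: a1; a2].
Proof.
rewrite hochschild_bE /hochschild_word /= ractE lactE /=.
rewrite !(linear_sub (dapp_linear _)) !dappE /=.
by rewrite expr2 mulN1r opprK scale1r !opprB [X in X - _ = _]addrC.
Qed.

Lemma connes_B0 a : connes_B (form a [::]) = form kone [:: a].
Proof. by rewrite connes_BE /connes_word big_ord1 expr0 scale1r. Qed.

Lemma connes_B1 a0 a1 :
  connes_B (form a0 [:: a1]) = form kone [:: a0; a1] - form kone [:: a1; a0].
Proof.
rewrite connes_BE /connes_word big_ord_recl big_ord1 /= expr0 expr1.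
by rewrite scale1r scaleN1r.
Qed.
End LowDegrees.

Lemma Sh_trivial (k : comNzRingType) (V P : lmodType k) p q (F : seq V -> P) z :
  (p + q <= 1)%N -> size z = (p + q)%N -> Sh p q F z = F z.
Proof.
move=> le1 sz.
have ord_eq0 (i : 'I_(p + q)) : val i = 0%N.
  by apply/eqP; rewrite -leqn0 -ltnS (leq_trans (ltn_ord i)).
have w1 (w : 'S_(p + q)) : w = 1%g.
  by apply/permP => i; apply/val_inj; rewrite !ord_eq0.
have ok : is_shuffle (1%g : 'S_(p + q)).
  by apply/forallP => i; apply/forallP => j; rewrite !perm1; apply/implyP => /andP[].
rewrite /Sh (bigD1 1%g) //= big1 ?addr0 => [|w /andP[_ /eqP[]]//].
rewrite odd_perm1 scale1r /permuted; congr F.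
transitivity [seq z`_i | i <- map val (enum 'I_(p + q))].
  by rewrite -map_comp; apply: eq_map => i /=; rewrite invg1 perm1.
by rewrite val_enum_ord -sz map_nth_iota0 // take_size.
Qed.

(** * Three auxiliary algebras *)

Lemma regularZ (k : comNzRingType) (c a : k) : c *: (a : k^o) = c * a.
Proof. by []. Qed.

Section Dual.
Variables (k : comNzRingType).

(** The dual numbers k[x]/(x^2); the pair (a, b) is a + b x. *)
Definition dual : Type := (k^o * k^o)%type.
HB.instance Definition _ := GRing.Lmodule.copy dual (k^o * k^o)%type.

Definition dual_mul (s t : dual) : dual := (s.1 * t.1, s.1 * t.2 + s.2 * t.1).

Fact dual_mulA : associative dual_mul.
Proof.
by move=> [a b] [c d] [e f]; rewrite /dual_mul /=; congr (_, _); ring.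
Qed.
Fact dual_mul1x : left_id ((1, 0) : dual) dual_mul.
Proof. by move=> [a b]; rewrite /dual_mul /=; congr (_, _); ring. Qed.
Fact dual_mulx1 : right_id ((1, 0) : dual) dual_mul.
Proof. by move=> [a b]; rewrite /dual_mul /=; congr (_, _); ring. Qed.
Fact dual_linearl t : linear (dual_mul^~ t).
Proof.
move: t => [a b] c [d e] [f g]; rewrite /dual_mul /=.
by congr (_, _); rewrite /= !regularZ; ring.
Qed.
Fact dual_linearr t : linear (dual_mul t).
Proof.
move: t => [a b] c [d e] [f g]; rewrite /dual_mul /=.
by congr (_, _); rewrite /= !regularZ; ring.
Qed.
HB.instance Definition _ := Lmodule_isUnitalAlgebra.Build k dual
  dual_mulA dual_mul1x dual_mulx1 dual_linearl dual_linearr.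
End Dual.

Section Triangular.
Variables (k : comNzRingType) (C : kalgType k).

(** Upper triangular 2 x 2 matrices; ((a, m), d) has diagonal a, d and corner m. *)
Definition triangular : Type := (C * C * C)%type.
HB.instance Definition _ := GRing.Lmodule.copy triangular (C * C * C)%type.

Definition triangular_mul (s t : triangular) : triangular :=
  (s.1.1 ∙ t.1.1, s.1.1 ∙ t.1.2 + s.1.2 ∙ t.2, s.2 ∙ t.2).

Fact triangular_mulA : associative triangular_mul.
Proof.
move=> [[a m] d] [[a' m'] d'] [[a'' m''] d'']; rewrite /triangular_mul /=.
by rewrite kmulDl kmulDr !kmulA addrA.
Qed.
Fact triangular_mul1x : left_id ((kone, 0, kone) : triangular) triangular_mul.
Proof.
by move=> [[a m] d]; rewrite /triangular_mul /= !kmul1x kmul0x addr0.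
Qed.
Fact triangular_mulx1 : right_id ((kone, 0, kone) : triangular) triangular_mul.
Proof.
by move=> [[a m] d]; rewrite /triangular_mul /= !kmulx1 kmulx0 add0r.
Qed.
Fact triangular_linearl t : linear (triangular_mul^~ t).
Proof.
move: t => [[a m] d] c [[a' m'] d'] [[a'' m''] d''].
rewrite /triangular_mul /= !kmul_linearl; congr (_, _, _) => /=.
by rewrite scalerDr addrACA.
Qed.
Fact triangular_linearr t : linear (triangular_mul t).
Proof.
move: t => [[a m] d] c [[a' m'] d'] [[a'' m''] d''].
rewrite /triangular_mul /= !kmul_linearr; congr (_, _, _) => /=.
by rewrite scalerDr addrACA.
Qed.
HB.instance Definition _ := Lmodule_isUnitalAlgebra.Build k triangular
  triangular_mulA triangular_mul1x triangular_mulx1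
  triangular_linearl triangular_linearr.

Definition diag11 (t : triangular) : C := t.1.1.
Definition diag22 (t : triangular) : C := t.2.
(** Conjugation by the unipotent matrix 1 + e12; it maps e11 to e11 + e12. *)
Definition shear (t : triangular) : triangular := (t.1.1, t.1.2 + t.1.1 - t.2, t.2).

Lemma diag11_morphism : kalg_morphism diag11.
Proof. by []. Qed.
Lemma diag22_morphism : kalg_morphism diag22.
Proof. by []. Qed.

Lemma shear_morphism : kalg_morphism shear.
Proof.
split=> [c [[a m] d] [[a' m'] d']||[[a m] d] [[a' m'] d']].
- congr (_, _, _) => /=; rewrite scalerBr scalerDr opprD.
  by rewrite [X in X + _ = _]addrACA [LHS]addrACA.
- rewrite -[kone]/((kone, 0, kone) : triangular) /shear /=.
  by rewrite add0r subrr.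
congr (_, _, _) => /=.
rewrite (linear_sub (kmul_linearl d')) (linear_sub (kmul_linearr a)) kmulDl !kmulDr.
rewrite [m ∙ d' + _]addrC -[X in _ = _ + X]addrA [RHS]addrA subrK addrA addrAC.
by rewrite [RHS]addrAC [X in X - _ = _]addrAC.
Qed.
End Triangular.

Section UVAlgebra.
Variables (k : comNzRingType).

(** The quotient of the free algebra on u and v by u^2, v^2 and all words of
length 3, with coordinates along 1, u, v, uv, vu.  The two terms of the commutator
of u and v are independent in it, and the commutator has square zero. *)
Definition uv_alg : Type := (k^o * k^o * k^o * k^o * k^o)%type.
HB.instance Definition _ := GRing.Lmodule.copy uv_alg (k^o * k^o * k^o * k^o * k^o)%type.

Definition uv_alg_mul (x y : uv_alg) : uv_alg :=
  let: (s, a, b, p, q) := x in let: (s', a', b', p', q') := y in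
  (s * s', s * a' + a * s', s * b' + b * s',
   s * p' + p * s' + a * b', s * q' + q * s' + b * a').

Fact uv_alg_mulA : associative uv_alg_mul.
Proof.
move=> [[[[s a] b] p] q] [[[[s' a'] b'] p'] q'] [[[[s'' a''] b''] p''] q''].
by rewrite /uv_alg_mul; congr (_, _, _, _, _); ring.
Qed.
Fact uv_alg_mul1x : left_id ((1, 0, 0, 0, 0) : uv_alg) uv_alg_mul.
Proof.
by move=> [[[[s a] b] p] q]; rewrite /uv_alg_mul; congr (_, _, _, _, _); ring.
Qed.
Fact uv_alg_mulx1 : right_id ((1, 0, 0, 0, 0) : uv_alg) uv_alg_mul.
Proof.
by move=> [[[[s a] b] p] q]; rewrite /uv_alg_mul; congr (_, _, _, _, _); ring.
Qed.
Fact uv_alg_linearl y : linear (uv_alg_mul^~ y).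
Proof.
move: y => [[[[s a] b] p] q] c [[[[s' a'] b'] p'] q'] [[[[s'' a''] b''] p''] q''].
by rewrite /uv_alg_mul /=; congr (_, _, _, _, _); rewrite /= !regularZ; ring.
Qed.
Fact uv_alg_linearr x : linear (uv_alg_mul x).
Proof.
move: x => [[[[s a] b] p] q] c [[[[s' a'] b'] p'] q'] [[[[s'' a''] b''] p''] q''].
by rewrite /uv_alg_mul /=; congr (_, _, _, _, _); rewrite /= !regularZ; ring.
Qed.
HB.instance Definition _ := Lmodule_isUnitalAlgebra.Build k uv_alg
  uv_alg_mulA uv_alg_mul1x uv_alg_mulx1 uv_alg_linearl uv_alg_linearr.

(** The substitution of uv - vu for x. *)
Definition dual_to_uv (x : dual k) : uv_alg := (x.1, 0, 0, x.2, - x.2).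

Lemma dual_to_uv_morphism : kalg_morphism dual_to_uv.
Proof.
split=> [c [a b] [a' b']||[a b] [a' b']].
- by congr (_, _, _, _, _); rewrite /= ?regularZ; ring.
- by rewrite -[kone]/((1, 0) : dual k) /dual_to_uv oppr0.
by congr (_, _, _, _, _); rewrite /=; ring.
Qed.

(** Sends u to the matrix unit e12 and v to the scalar matrix x. *)
Definition uv_to_triangular (y : uv_alg) : triangular (dual k) :=
  let: (s, a, b, p, q) := y in
  let diag := (s, b) : dual k in (diag, (a, p + q) : dual k, diag).

Lemma uv_to_triangular_morphism : kalg_morphism uv_to_triangular.
Proof.
split=> [c||].
- move=> [[[[s a] b] p] q] [[[[s' a'] b'] p'] q'].
  by congr ((_, _), (_, _), (_, _)); rewrite /= ?regularZ; ring.
- rewrite -[kone]/((1, 0, 0, 0, 0) : uv_alg) /uv_to_triangular.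
  by rewrite addr0.
move=> [[[[s a] b] p] q] [[[[s' a'] b'] p'] q'].
by congr ((_, _), (_, _), (_, _)); rewrite /=; ring.
Qed.

Definition uv_swap (y : uv_alg) : uv_alg :=
  let: (s, a, b, p, q) := y in (s, b, a, q, p).

Lemma uv_swap_morphism : kalg_morphism uv_swap.
Proof.
split=> //; last first.
  move=> [[[[s a] b] p] q] [[[[s' a'] b'] p'] q'].
  by congr (_, _, _, _, _).
by move=> c [[[[s a] b] p] q] [[[[s' a'] b'] p'] q'].
Qed.
End UVAlgebra.

(** * Linear maps on forms of one degree *)

Section Coefficients.
Variables (k : comNzRingType) (C : kalgType k) (P : lmodType k).

Definition deg0_map (F : C -> P) : Omega C -> P :=
  olift (fun a0 s => if s is [::] then F a0 else 0).

Definition deg1_map (F : C -> C -> P) : Omega C -> P :=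
  olift (fun a0 s => if s is [:: a1] then F a0 a1 else 0).

Definition deg2_map (F : C -> C -> C -> P) : Omega C -> P :=
  olift (fun a0 s => if s is [:: a1; a2] then F a0 a1 a2 else 0).

Definition normal1 (F : C -> C -> P) :=
  [/\ forall b, linear (F^~ b), forall a, linear (F a) & forall a, F a kone = 0].

Definition normal2 (F : C -> C -> C -> P) :=
  [/\ forall b c, linear (fun a => F a b c), forall a, normal1 (F a)
    & forall a c, F a kone c = 0].

Lemma deg0_map_form_map (F : C -> P) : linear F ->
  form_map (fun a0 (s : seq C) => if s is [::] then F a0 else 0).
Proof.
move=> Fl; split=> [[|x s] c a b|a0 [|y s1] c a b s2|a0 [|y s1] s2] //=;
  by rewrite ?Fl ?scaler0 ?addr0.
Qed.

Lemma deg1_map_form_map (F : C -> C -> P) : normal1 F ->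
  form_map (fun a0 (s : seq C) => if s is [:: a1] then F a0 a1 else 0).
Proof.
move=> [Fl Fr F1]; split=> [[|x [|y s]] c a b|a0 [|y [|z s1]] c a b [|t s2]|
  a0 [|y [|z s1]] [|t s2]] //=;
  by rewrite ?Fl ?Fr ?F1 ?scaler0 ?addr0.
Qed.

Lemma deg2_map_form_map (F : C -> C -> C -> P) : normal2 F ->
  form_map (fun a0 (s : seq C) => if s is [:: a1; a2] then F a0 a1 a2 else 0).
Proof.
move=> [F0 FF F1]; split=> [[|x [|y [|z s]]] c a b|
  a0 [|y [|z [|w s1]]] c a b [|t [|t' s2]]|
  a0 [|y [|z [|w s1]]] [|t [|t' s2]]] //=; rewrite ?F0 ?F1 ?scaler0 ?addr0 //;
  by case: (FF a0) => Fl Fr Fn; rewrite ?Fl ?Fr ?Fn.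
Qed.

Lemma deg0_mapE F a0 s : linear F ->
  deg0_map F (form a0 s) = if s is [::] then F a0 else 0.
Proof. by move=> Fl; apply: (oliftE (deg0_map_form_map Fl)). Qed.
Lemma deg1_mapE F a0 s : normal1 F ->
  deg1_map F (form a0 s) = if s is [:: a1] then F a0 a1 else 0.
Proof. by move=> Ff; apply: (oliftE (deg1_map_form_map Ff)). Qed.
Lemma deg2_mapE F a0 s : normal2 F ->
  deg2_map F (form a0 s) = if s is [:: a1; a2] then F a0 a1 a2 else 0.
Proof. by move=> Ff; apply: (oliftE (deg2_map_form_map Ff)). Qed.

Lemma deg0_map_linear F : linear F -> linear (deg0_map F).
Proof. by move=> Fl; apply: (olift_linear (deg0_map_form_map Fl)). Qed.
Lemma deg1_map_linear F : normal1 F -> linear (deg1_map F).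
Proof. by move=> Ff; apply: (olift_linear (deg1_map_form_map Ff)). Qed.
Lemma deg2_map_linear F : normal2 F -> linear (deg2_map F).
Proof. by move=> Ff; apply: (olift_linear (deg2_map_form_map Ff)). Qed.

End Coefficients.

Lemma deg0_map_Omap (k : comNzRingType) (A C : kalgType k) (P : lmodType k)
    (f : A -> C) (F : C -> P) w : kalg_morphism f -> linear F ->
  deg0_map F (Omap f w) = deg0_map (fun a => F (f a)) w.
Proof.
move=> [fl f1 _] Fl; have Gl := linear_compose fl Fl.
apply: (Omega_eq (linear_compose (Omap_linear fl f1) (deg0_map_linear Fl))
  (deg0_map_linear Gl)) => a s.
by rewrite OmapE // !deg0_mapE //; case: s.
Qed.

Lemma normal1_comp (k : comNzRingType) (A C : kalgType k) (P : lmodType k)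
    (f : A -> C) (F : C -> C -> P) : kalg_morphism f -> normal1 F ->
  normal1 (fun a b => F (f a) (f b)).
Proof.
move=> [fl f1 _] [Fl Fr F1]; split=> [b c x y|a c x y|a];
  by rewrite ?fl ?f1 ?Fl ?Fr ?F1.
Qed.

Lemma deg1_map_Omap (k : comNzRingType) (A C : kalgType k) (P : lmodType k)
    (f : A -> C) (F : C -> C -> P) w : kalg_morphism f -> normal1 F ->
  deg1_map F (Omap f w) = deg1_map (fun a b => F (f a) (f b)) w.
Proof.
move=> fM FN; have Gl := normal1_comp fM FN; have [fl f1 _] := fM.
apply: (Omega_eq (linear_compose (Omap_linear fl f1) (deg1_map_linear FN))
  (deg1_map_linear Gl)) => a s.
by rewrite OmapE // !deg1_mapE //; case: s => [|x []].
Qed.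

(** * Natural endomorphisms of forms that commute with b up to a scalar *)

Section Functionals.
Variable k : comNzRingType.
Notation D := (dual k).
Notation T := (triangular D).

Definition dual_const (a : D) : k^o := a.1.
Definition dual_slope (a : D) : k^o := a.2.

Lemma dual_const_linear : linear dual_const. Proof. by []. Qed.
Lemma dual_slope_linear : linear dual_slope. Proof. by []. Qed.

(** a0 da1 |-> a0(0) a1'(0), the Hochschild 1-cocycle of the derivation d/dx at
the point x = 0. *)
Definition dual_cocycle (a0 a1 : D) : k^o := a0.1 * a1.2.

Lemma dual_cocycle_normal : normal1 dual_cocycle.
Proof.
split=> [[b b'] c [x x'] [y y']|[a a'] c [x x'] [y y']|[a a']];
  rewrite /dual_cocycle /= ?regularZ; [ring|ring|exact: mulr0].
Qed.

(** The corner entry of the matrix product a0 (d/dx a1) at x = 0: the same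
formula as for the dual numbers, with matrix coefficients. *)
Definition corner_cocycle (a0 a1 : T) : k^o :=
  a0.1.1.1 * a1.1.2.2 + a0.1.2.1 * a1.2.2.

Lemma corner_cocycle_normal : normal1 corner_cocycle.
Proof.
split=> [b c [[[x ?] [x' ?]] [x'' ?]] [[[y ?] [y' ?]] [y'' ?]]
  |a c [[? [? x]] [? x']] [[? [? y]] [? y']]|a];
  rewrite /corner_cocycle /= ?regularZ; [ring|ring|].
by rewrite !mulr0 addr0.
Qed.

Definition uv_coef (y : uv_alg k) : k^o := y.1.2.

Lemma uv_coef_linear : linear uv_coef. Proof. by []. Qed.
Definition eps : D := (0, 1).
Definition diag (a d : D) : T := (a, 0, d).
Definition corner_unit : T := (0, kone, 0).
Definition uv_u : uv_alg k := (0, 1, 0, 0, 0).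
Definition uv_v : uv_alg k := (0, 0, 1, 0, 0).
End Functionals.
Arguments eps {k}.
Arguments corner_unit {k}.
Arguments uv_u {k}.
Arguments uv_v {k}.

Section DegreeMapLemmas.
Variables (k : comNzRingType) (C : kalgType k) (P : lmodType k).

Lemma normal1_sub (F G : C -> C -> P) : normal1 F -> normal1 G ->
  normal1 (fun a b => F a b - G a b).
Proof.
move=> [Fl Fr F1] [Gl Gr G1]; split=> [b c x y|a c x y|a].
- by rewrite Fl Gl scalerBr opprD addrACA.
- by rewrite Fr Gr scalerBr opprD addrACA.
by rewrite F1 G1 subr0.
Qed.

Lemma deg1_map_sub (F G : C -> C -> P) w : normal1 F -> normal1 G ->
  deg1_map (fun a b => F a b - G a b) w = deg1_map F w - deg1_map G w.
Proof.
move=> FN GN; rewrite addrC -scaleN1r -olift_comb; apply: eq_olift => a0.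
by case=> [|a1 []] *; rewrite ?scaleN1r ?oppr0 ?addr0 // addrC.
Qed.

Lemma eq_deg1_map (F G : C -> C -> P) w : F =2 G -> deg1_map F w = deg1_map G w.
Proof. by move=> FG; apply: eq_olift => a0 [|a1 []]. Qed.

Lemma form_at0 s : form (0 : C) s = 0.
Proof. exact: (linear_at0 (formDl s)). Qed.

Lemma form_sub (a b : C) s : form (a - b) s = form a s - form b s.
Proof. exact: (linear_sub (formDl s)). Qed.

Lemma form1_sub (a x y : C) : form a [:: x - y] = form a [:: x] - form a [:: y].
Proof.
apply: (linear_sub (f := fun x => form a [:: x])) => c u v.
exact: (@form_multilinear _ _ a [::]).
Qed.

Lemma form1_at0 (a : C) : form a [:: 0] = 0.
Proof. by rewrite -(subrr (0 : C)) form1_sub subrr. Qed.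
End DegreeMapLemmas.

Section NaturalEndomorphism.
Variables (k : comNzRingType) (N : forall A : kalgType k, Omega A -> Omega A).
Variable s : k.
Hypothesis N_linear : forall A, linear (@N A).
Hypothesis N_natural : forall (A A' : kalgType k) (f : A -> A') w,
  kalg_morphism f -> N (Omap f w) = Omap f (N w).
Hypothesis N_deg1 : forall (A : kalgType k) (u v : A),
  Omega_deg 1 (N (form u [:: v])).
Hypothesis N_b : forall (A : kalgType k) (u v : A),
  hochschild_b (N (form u [:: v])) = s *: N (hochschild_b (form u [:: v])).
Notation D := (dual k).
Notation T := (triangular D).
Notation corner := (deg1_map (@corner_cocycle k)).
Notation tau := (deg1_map (@dual_cocycle k)).

Let corner_linear : linear corner.
Proof. exact: deg1_map_linear (corner_cocycle_normal k). Qed.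

(** On diagonal matrices the corner entry is zero, and after the shear it is the
difference of the two diagonal entries; this is the first-order form of that
remark. *)
Lemma corner_shear (w : Omega T) :
  corner (Omap (@shear _ D) w) - corner w
  = tau (Omap (@diag11 _ D) w) - tau (Omap (@diag22 _ D) w).
Proof.
have cN := corner_cocycle_normal k; have dN := dual_cocycle_normal k.
have sM := shear_morphism D.
have M1 := diag11_morphism D; have M2 := diag22_morphism D.
rewrite !deg1_map_Omap // -!deg1_map_sub //; try exact: normal1_comp.
apply: eq_deg1_map => -[[[a a'] [m m']] [d d']] [[[b b'] [n n']] [e e']].
by rewrite /corner_cocycle /dual_cocycle /=; ring.
Qed.

(** The matrix unit e12 is a difference of two conjugate idempotents.  This is what
turns a statement about the nilpotent e12 into one about the unit. *)
Lemma shear_diag : shear (diag kone 0 : T) - diag kone 0 = corner_unit.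
Proof.
by rewrite /shear /diag /= !(subr0, add0r); congr (_, _, _); rewrite /= ?subrr ?subr0.
Qed.

Let xT : T := diag eps eps.

Lemma shear_xT : shear xT = xT.
Proof. by rewrite /shear /xT /diag /= add0r subrr. Qed.

(** By linearity e12 is replaced by the idempotents e11 + e12 and e11.  The shear
fixes x, so [corner_shear] leaves the values at the two diagonal entries of e11,
which are 1 and 0. *)
Lemma corner_unit_dx : corner (N (form corner_unit [:: xT])) = tau (N (form kone [:: eps])).
Proof.
have [sl s1 _] := shear_morphism D; have [l1 n1 _] := diag11_morphism D.
have [l2 n2 _] := diag22_morphism D.
rewrite -shear_diag form_sub (linear_sub (@N_linear _)) (linear_sub corner_linear).
rewrite -{1}shear_xT -[[:: shear xT]]/(map (@shear _ D) [:: xT]) -OmapE //.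
rewrite N_natural; last exact: shear_morphism.
rewrite corner_shear -!N_natural; [|exact: diag22_morphism|exact: diag11_morphism].
rewrite !OmapE // /diag11 /diag22 /= form_at0 (linear_at0 (@N_linear _)).
by rewrite (linear_at0 (deg1_map_linear (dual_cocycle_normal k))) subr0.
Qed.

(** The same argument as for [corner_unit_dx] gives the values at d1 and d0, which
are both zero. *)
Lemma x_dcorner_unit : corner (N (form xT [:: corner_unit])) = 0.
Proof.
have [sl s1 _] := shear_morphism D; have [l1 n1 _] := diag11_morphism D.
have [l2 n2 _] := diag22_morphism D.
rewrite -shear_diag form1_sub (linear_sub (@N_linear _)) (linear_sub corner_linear).
rewrite -{1}shear_xT -[[:: shear _]]/(map (@shear _ D) [:: diag kone 0]) -OmapE //.
rewrite N_natural; last exact: shear_morphism.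
rewrite corner_shear -!N_natural; [|exact: diag22_morphism|exact: diag11_morphism].
rewrite !OmapE // /diag11 /diag22 /=.
by rewrite (form_normalized eps [::] [::]) form1_at0 subrr.
Qed.

(** A natural endomorphism acts on dx by the same scalar as on x, up to s.  The
coefficient of uv in b(N(u dv)) is computed in two ways: through N([u, v]), and
through the two triangular representations of N(u dv), where u, respectively v,
becomes e12. *)
Lemma natural_endo_slope :
  tau (N (form kone [:: eps])) = s * deg0_map (@dual_slope k) (N (form eps [::])).
Proof.
have cN := corner_cocycle_normal k.
have eM := uv_to_triangular_morphism k; have wM := uv_swap_morphism k.
have cM := dual_to_uv_morphism k.
have [el e1 _] := eM; have [wl w1 _] := wM; have [cl c1 _] := cM.
pose W := N (form uv_u [:: uv_v : uv_alg k]).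
have E1 : Omap (@uv_to_triangular k) W = N (form corner_unit [:: xT]).
  by rewrite /W -N_natural // OmapE // /uv_to_triangular /= addr0.
have E2 : Omap (@uv_to_triangular k) (Omap (@uv_swap k) W) = N (form xT [:: corner_unit]).
  by rewrite /W -!N_natural // !OmapE // /uv_to_triangular /= addr0.
(* The coefficient of uv in [a0, a1] only involves the coordinates along u and v:
   in the difference of the two corner values, the contributions of uv and vu
   cancel. *)
have Wb : corner (Omap (@uv_to_triangular k) W)
    - corner (Omap (@uv_to_triangular k) (Omap (@uv_swap k) W))
    = deg0_map (@uv_coef k) (hochschild_b W).
  have F1 := normal1_comp eM cN; have F2 := normal1_comp wM F1.
  rewrite !deg1_map_Omap // -deg1_map_sub //.
  have Gl := linear_compose (@hochschild_b_linear _ (uv_alg k))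
    (deg0_map_linear (@uv_coef_linear k)).
  have FN := normal1_sub F1 F2.
  apply: (Omega_deg_eq (deg1_map_linear FN) Gl) (N_deg1 _ _) => a0 [|a1 []] // _.
  rewrite hochschild_b1 (linear_sub (deg0_map_linear (@uv_coef_linear k))).
  rewrite deg1_mapE // !(deg0_mapE _ _ (@uv_coef_linear k)).
  move: a0 a1 => [[[[t a] b] p] q] [[[[t' a'] b'] p'] q'].
  by rewrite /corner_cocycle /uv_coef /=; ring.
rewrite -corner_unit_dx -[LHS]subr0 -x_dcorner_unit -E1 -E2 Wb N_b.
rewrite hochschild_b1 -form_sub.
have -> : uv_u ∙ uv_v - uv_v ∙ uv_u = dual_to_uv eps :> uv_alg k.
  by rewrite /dual_to_uv; congr (_, _, _, _, _); rewrite /=; ring.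
rewrite (linear_scale (deg0_map_linear (@uv_coef_linear k))).
rewrite -[[::]]/(map (@dual_to_uv k) [::]) -OmapE // N_natural //.
by rewrite deg0_map_Omap // => ?.
Qed.
End NaturalEndomorphism.

(** * Contraction of forms with a derivation *)

Section Contraction.
Variables (k : comNzRingType) (T C : kalgType k) (E P : T -> C).

(** Cap product with the derivation P along the morphism E, in degrees 1 and 2.  The
last entry is moved to the front, as in the cyclic term of b, so P t_n stands to
the left of E t_0. *)
Definition contract_last (w : Omega T) : Omega C :=
  deg1_map (fun t0 t1 => form (P t1 ∙ E t0) [::]) w
  + deg2_map (fun t0 t1 t2 => form (P t2 ∙ E t0) [:: E t1]) w.

(** The same cap product with the derivation in the first entry, to the right of
E t_0. *)
Definition contract_first (w : Omega T) : Omega C :=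
  deg1_map (fun t0 t1 => form (E t0 ∙ P t1) [::]) w
  + deg2_map (fun t0 t1 t2 => form (E t0 ∙ P t1) [:: E t2]) w.

Hypothesis EM : kalg_morphism E.
Hypothesis Pl : linear P.
Hypothesis PM : forall s t, P (s ∙ t) = P s ∙ E t + E s ∙ P t.

Let El : linear E. Proof. by case: EM. Qed.
Let E1 : E kone = kone. Proof. by case: EM. Qed.
Let EMul : {morph E : s t / s ∙ t}. Proof. by case: EM. Qed.

Lemma derivation_kone : P kone = 0.
Proof.
have := PM kone kone; rewrite kmul1x E1 kmulx1 kmul1x => /eqP.
by rewrite addrC -subr_eq subrr eq_sym => /eqP.
Qed.

Let form_entry_linear (c : C) : linear (fun x => form c [:: x]).
Proof. by move=> d x y; apply: (@form_multilinear _ _ c [::]). Qed.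

Let form_kone (c : C) : form c [:: kone] = 0.
Proof. exact: (form_normalized c [::]). Qed.

Lemma contract_last1_normal : normal1 (fun t0 t1 => form (P t1 ∙ E t0) [::]).
Proof.
split=> [t1 c x y|t0 c x y|t0].
- by rewrite El kmul_linearr formDl.
- by rewrite Pl kmul_linearl formDl.
by rewrite derivation_kone kmul0x form_at0.
Qed.

Lemma contract_last2_normal :
  normal2 (fun t0 t1 t2 => form (P t2 ∙ E t0) [:: E t1]).
Proof.
split=> [t1 t2 c x y|t0|t0 t2].
- by rewrite El kmul_linearr formDl.
- split=> [t2 c x y|t1 c x y|t1].
  + by rewrite El form_entry_linear.
  + by rewrite Pl kmul_linearl formDl.
  by rewrite derivation_kone kmul0x form_at0.
by rewrite E1 form_kone.
Qed.

Lemma contract_first1_normal : normal1 (fun t0 t1 => form (E t0 ∙ P t1) [::]).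
Proof.
split=> [t1 c x y|t0 c x y|t0].
- by rewrite El kmul_linearl formDl.
- by rewrite Pl kmul_linearr formDl.
by rewrite derivation_kone kmulx0 form_at0.
Qed.

Lemma contract_first2_normal :
  normal2 (fun t0 t1 t2 => form (E t0 ∙ P t1) [:: E t2]).
Proof.
split=> [t1 t2 c x y|t0|t0 t2].
- by rewrite El kmul_linearl formDl.
- split=> [t2 c x y|t1 c x y|t1].
  + by rewrite Pl kmul_linearr formDl.
  + by rewrite El form_entry_linear.
  by rewrite E1 form_kone.
by rewrite derivation_kone kmulx0 form_at0.
Qed.

Lemma contract_last_linear : linear contract_last.
Proof.
move=> c x y; rewrite /contract_last (deg1_map_linear contract_last1_normal).
by rewrite (deg2_map_linear contract_last2_normal) scalerDr addrACA.
Qed.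

Lemma contract_first_linear : linear contract_first.
Proof.
move=> c x y; rewrite /contract_first (deg1_map_linear contract_first1_normal).
by rewrite (deg2_map_linear contract_first2_normal) scalerDr addrACA.
Qed.

Lemma contract_lastE t0 s : contract_last (form t0 s) =
  match s with
  | [:: t1] => form (P t1 ∙ E t0) [::]
  | [:: t1; t2] => form (P t2 ∙ E t0) [:: E t1]
  | _ => 0
  end.
Proof.
rewrite /contract_last (deg1_mapE _ _ contract_last1_normal).
rewrite (deg2_mapE _ _ contract_last2_normal).
by case: s => [|t1 [|t2 []]] *; rewrite ?addr0 ?add0r.
Qed.

Lemma contract_firstE t0 s : contract_first (form t0 s) =
  match s with
  | [:: t1] => form (E t0 ∙ P t1) [::]
  | [:: t1; t2] => form (E t0 ∙ P t1) [:: E t2]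
  | _ => 0
  end.
Proof.
rewrite /contract_first (deg1_mapE _ _ contract_first1_normal).
rewrite (deg2_mapE _ _ contract_first2_normal).
by case: s => [|t1 [|t2 []]] *; rewrite ?addr0 ?add0r.
Qed.

(** Both sides come out as the commutator of P t2 E t0 with E t1: by the Leibniz
rule, the part P t1 E t2 of the middle term of b cancels the cyclic term. *)
Lemma contract_last_b w : Omega_deg 2 w ->
  contract_last (hochschild_b w) = hochschild_b (contract_last w).
Proof.
have lin := contract_last_linear; have bl D := @hochschild_b_linear k D.
move: w; apply: (Omega_deg_eq (linear_compose (bl T) lin)
  (linear_compose lin (bl C))) => t0 [|t1 [|t2 []]] // _.
rewrite contract_lastE hochschild_b1 hochschild_b2 (linear_add lin) (linear_sub lin).
rewrite !contract_lastE !EMul PM kmulDl (linear_add (formDl _)) !kmulA.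
by rewrite opprD addrA addrAC subrK.
Qed.

(** Here the part E t1 P t2 of the middle term of b cancels its first term, and the
commutator of E t0 P t1 with E t2 remains with the opposite sign. *)
Lemma contract_first_b w : Omega_deg 2 w ->
  contract_first (hochschild_b w) = - hochschild_b (contract_first w).
Proof.
have lin := contract_first_linear; have bl D := @hochschild_b_linear k D.
have nl : linear (fun w => - hochschild_b (contract_first w)).
  by move=> c x y; rewrite lin bl opprD scalerN.
move: w; apply: (Omega_deg_eq (linear_compose (bl T) lin) nl) => t0 [|t1 [|t2 []]] // _.
rewrite contract_firstE hochschild_b1 hochschild_b2 (linear_add lin) (linear_sub lin).
rewrite !contract_firstE !EMul PM kmulDr (linear_add (formDl _)) !kmulA.
by rewrite opprB [X in _ - X + _]addrC opprD addrA subrr add0r addrC.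
Qed.

Lemma contract_last_deg w : Omega_deg 2 w -> Omega_deg 1 (contract_last w).
Proof.
apply: (Omega_deg_map contract_last_linear) => t0 [|t1 [|t2 []]] // _.
by rewrite contract_lastE; apply: (Omega_deg_form _ [:: _]).
Qed.

Lemma contract_first_deg w : Omega_deg 2 w -> Omega_deg 1 (contract_first w).
Proof.
apply: (Omega_deg_map contract_first_linear) => t0 [|t1 [|t2 []]] // _.
by rewrite contract_firstE; apply: (Omega_deg_form _ [:: _]).
Qed.
End Contraction.

Section ContractionNatural.
Variables (k : comNzRingType) (T C T' C' : kalgType k).
Variables (E P : T -> C) (E' P' : T' -> C') (F : T -> T') (f : C -> C').
Hypotheses (EM : kalg_morphism E) (Pl : linear P).
Hypothesis PM : forall s t, P (s ∙ t) = P s ∙ E t + E s ∙ P t.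
Hypotheses (EM' : kalg_morphism E') (Pl' : linear P').
Hypothesis PM' : forall s t, P' (s ∙ t) = P' s ∙ E' t + E' s ∙ P' t.
Hypotheses (FM : kalg_morphism F) (fM : kalg_morphism f).
Hypotheses (EF : forall t, E' (F t) = f (E t)) (PF : forall t, P' (F t) = f (P t)).

Lemma contract_last_natural w :
  contract_last E' P' (Omap F w) = Omap f (contract_last E P w).
Proof.
have [Fl F1 _] := FM; have [fl f1 fmul] := fM.
move: w; apply: Omega_eq.
- exact: linear_compose (Omap_linear Fl F1) (contract_last_linear EM' Pl' PM').
- exact: linear_compose (contract_last_linear EM Pl PM) (Omap_linear fl f1).
move=> t0 s; rewrite OmapE // !contract_lastE //.
case: s => [|t1 [|t2 []]] *; rewrite /= ?(linear_at0 (Omap_linear fl f1)) ?OmapE //=.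
  by rewrite fmul EF PF.
by rewrite fmul !EF PF.
Qed.

Lemma contract_first_natural w :
  contract_first E' P' (Omap F w) = Omap f (contract_first E P w).
Proof.
have [Fl F1 _] := FM; have [fl f1 fmul] := fM.
move: w; apply: Omega_eq.
- exact: linear_compose (Omap_linear Fl F1) (contract_first_linear EM' Pl' PM').
- exact: linear_compose (contract_first_linear EM Pl PM) (Omap_linear fl f1).
move=> t0 s; rewrite OmapE // !contract_firstE //.
case: s => [|t1 [|t2 []]] *; rewrite /= ?(linear_at0 (Omap_linear fl f1)) ?OmapE //=.
  by rewrite fmul EF PF.
by rewrite fmul !EF PF.
Qed.
End ContractionNatural.

(** * Evaluation and differentiation on a tensor product with dual numbers *)

Section Swap.
Variables (k : comNzRingType) (A B : kalgType k).

Lemma tswap_morphism : kalg_morphism (@tswap _ A B).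
Proof.
have sl := @tswap_linear k A B; split => //; first by rewrite tswapE.
move=> s t; move: s; apply: tens_eq => [c x y|c x y|a b].
- by rewrite kmul_linearl sl.
- by rewrite sl kmul_linearl.
move: t; apply: tens_eq => [c x y|c x y|a' b'].
- by rewrite kmul_linearr sl.
- by rewrite sl kmul_linearr.
by rewrite tensM !tswapE tensM.
Qed.
End Swap.

Section Contract.
Variables (k : comNzRingType).
Notation D := (dual k).

Section OneAlgebra.
Variable A : kalgType k.

(** Instances: the value at y = 0 ([const_r]), a morphism, and the coefficient
of y ([slope_r]), a derivation along it. *)
Definition eval_r (l : D -> k^o) : tens A D -> A := tlift (fun a d => l d *: a).

Section Evr.
Variable l : D -> k^o.
Hypothesis ll : linear l.

Lemma eval_r_bilin : bilin (fun (a : A) (d : D) => l d *: a).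
Proof.
split=> [d|a] c x y; first by rewrite scalerDr !scalerA mulrC.
by rewrite ll scalerDl -scalerA.
Qed.
Lemma eval_r_linear : linear (eval_r l).
Proof. exact: tlift_linear eval_r_bilin. Qed.
Lemma eval_rE a d : eval_r l (a ⊗ d) = l d *: a.
Proof. exact: tlift_pure eval_r_bilin a d. Qed.
End Evr.

Definition const_r := eval_r (@dual_const k).
Definition slope_r := eval_r (@dual_slope k).

Lemma const_r_linear : linear const_r. Proof. exact: eval_r_linear. Qed.
Lemma slope_r_linear : linear slope_r. Proof. exact: eval_r_linear. Qed.

Let kmulZZ (c d : k) (a b : A) : (c *: a) ∙ (d *: b) = (c * d) *: (a ∙ b).
Proof.
by rewrite (linear_scale (kmul_linearl _)) (linear_scale (kmul_linearr _)) scalerA.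
Qed.

Lemma const_r_morphism : kalg_morphism const_r.
Proof.
have sl := const_r_linear; split => //; first by rewrite /const_r eval_rE ?scale1r.
move=> s t; move: s; apply: tens_eq => [c x y|c x y|a b].
- by rewrite kmul_linearl sl.
- by rewrite sl kmul_linearl.
move: t; apply: tens_eq => [c x y|c x y|a' b'].
- by rewrite kmul_linearr sl.
- by rewrite sl kmul_linearr.
by rewrite tensM /const_r !eval_rE // kmulZZ.
Qed.

Lemma slope_r_derivation s t :
  slope_r (s ∙ t) = slope_r s ∙ const_r t + const_r s ∙ slope_r t.
Proof.
have sl := slope_r_linear; have cl' := const_r_linear.
move: s; apply: tens_eq => [c x y|c x y|a b].
- by rewrite kmul_linearl sl.
- by rewrite sl cl' !kmul_linearl scalerDr addrACA.
move: t; apply: tens_eq => [c x y|c x y|a' b'].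
- by rewrite kmul_linearr sl.
- by rewrite sl cl' !kmul_linearr scalerDr addrACA.
rewrite tensM /const_r /slope_r !eval_rE // !kmulZZ -scalerDl; congr (_ *: _).
by rewrite /dual_const /dual_slope /= addrC.
Qed.
End OneAlgebra.

Lemma eval_r_natural (A A' : kalgType k) (f : A -> A') l t : linear f -> linear l ->
  eval_r l (tmap f (fun d : D => d) t) = f (eval_r l t).
Proof.
move=> fl ll; have idl : linear (fun d : D => d) by [].
move: t; apply: tens_eq.
- exact: linear_compose (tmap_linear fl idl) (eval_r_linear ll).
- exact: linear_compose (eval_r_linear ll) fl.
by move=> a d; rewrite tmapE // !eval_rE // (linear_scale fl).
Qed.

Section Left.
Variable B : kalgType k.
Definition const_l (t : tens D B) : B := const_r (tswap t).
Definition slope_l (t : tens D B) : B := slope_r (tswap t).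

Lemma const_l_morphism : kalg_morphism const_l.
Proof.
have [sl s1 sM] := tswap_morphism D B; have [cl c1 cM] := const_r_morphism B.
split=> [c x y||x y]; rewrite /const_l; first by rewrite sl cl.
- by rewrite s1.
by rewrite sM.
Qed.
Lemma slope_l_linear : linear slope_l.
Proof. exact: linear_compose (@tswap_linear _ D B) (@slope_r_linear B). Qed.
Lemma slope_l_derivation s t :
  slope_l (s ∙ t) = slope_l s ∙ const_l t + const_l s ∙ slope_l t.
Proof.
have [sl s1 sM] := tswap_morphism D B.
by rewrite /slope_l /const_l sM slope_r_derivation.
Qed.
End Left.

Lemma tswap_natural (A A' B B' : kalgType k) (f : A -> A') (g : B -> B') t :
  linear f -> linear g ->
  tswap (tmap f g t) = tmap g f (tswap t).
Proof.
move=> fl gl; move: t; apply: tens_eq.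
- exact: linear_compose (tmap_linear fl gl) (@tswap_linear _ _ _).
- exact: linear_compose (@tswap_linear _ _ _) (tmap_linear gl fl).
by move=> a b; rewrite tmapE // !tswapE tmapE.
Qed.
End Contract.

(** * The two coextensions in low degrees *)

Section LowDegreeTensors.
Variables (k : comNzRingType) (A B : kalgType k).

Lemma tens0l (U V : lmodType k) (v : V) : (0 : U) ⊗ v = 0.
Proof. by have [bl _] := tpure_bilin U V; apply: (linear_at0 (bl v)). Qed.
Lemma tens0r (U V : lmodType k) (u : U) : u ⊗ (0 : V) = 0.
Proof. by have [_ br] := tpure_bilin U V; apply: (linear_at0 (br u)). Qed.

Lemma tens_deg_form (a0 : A) s (b0 : B) t :
  tens_deg (size s + size t) (form a0 s ⊗ form b0 t).
Proof.
exists [:: (form a0 s, form b0 t)]; last by rewrite big_seq1.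
move=> x; rewrite inE => /eqP ->; exists (size s), (size t).
by split=> //; apply: Omega_deg_form.
Qed.

Lemma tens_bE (a0 : A) s (b0 : B) t :
  tens_b (form a0 s ⊗ form b0 t) =
  hochschild_b (form a0 s) ⊗ form b0 t
  + ((-1) ^+ size s *: form a0 s) ⊗ hochschild_b (form b0 t).
Proof.
by rewrite /tens_b tens_opE ?omega_signE //; apply: hochschild_b_linear.
Qed.

Lemma tens_BE (a0 : A) s (b0 : B) t :
  tens_B (form a0 s ⊗ form b0 t) =
  connes_B (form a0 s) ⊗ form b0 t
  + ((-1) ^+ size s *: form a0 s) ⊗ connes_B (form b0 t).
Proof.
by rewrite /tens_B tens_opE ?omega_signE //; apply: connes_B_linear.
Qed.
End LowDegreeTensors.

Section LowShuffles.
Variables (k : comNzRingType) (A B : kalgType k).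

(** In total degree at most 1 there is a single shuffle, the identity, and the flip
has no sign. *)
Lemma sigma_sh_low (a0 : A) s (b0 : B) t : (size s + size t <= 1)%N ->
  sigma_sh_inf 0 (form a0 s ⊗ form b0 t) = sh_inf 0 (form a0 s ⊗ form b0 t).
Proof.
move=> le1; have [sl s1 _] := tswap_morphism B A.
rewrite /sigma_sh_inf /sh_inf flipE shE.
have -> : (size s * size t = 0)%N by move: le1; case: (size s) (size t) => [|[|n]] [|[|m]].
rewrite expr0 scale1r shE !Sh_trivial ?size_cat ?size_map // 1?addnC // OmapE // tswapE.
congr form; rewrite map_cat -!map_comp.
rewrite (eq_map (g := inB A)) => [|b]; last exact: tswapE.
rewrite [X in _ ++ X](eq_map (g := inA B)) => [|a]; last exact: tswapE.
by case: s t le1 => [|x s] [|y t] //=; rewrite ?cats0 // addnS.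
Qed.

(** Only the term r = p = 1 of phi contributes to phi(d(a b)), and it puts db before
da; this is the asymmetry that the proposition exploits. *)
Lemma sh_inf1_deg0 (a : A) (b : B) :
  sh_inf 1 (form a [::] ⊗ form b [::]) = form kone [:: inB A b; inA B a].
Proof.
rewrite /sh_inf /phi_inf /= shE Sh_trivial //= connes_B0 phiE /phi_word /=.
rewrite !big_ord_recl !big_ord0 /= big_mkcond !big_ord_recl !big_ord0 /=.
rewrite big_mkcond !big_ord_recl !big_ord0 /= !addr0 !add0r expr2 mulN1r opprK scale1r.
have -> : [:: a ⊗ b] = [::] ++ [seq x.1 ⊗ x.2 | x <- [:: (a, b)]] by [].
by rewrite phi_word_rpE // Sh_trivial //= kmulx1 kmulx1.
Qed.

End LowShuffles.

Lemma sigma_sh_inf1_deg0 (k : comNzRingType) (A B : kalgType k) (a : A) (b : B) :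
  sigma_sh_inf 1 (form a [::] ⊗ form b [::]) = form kone [:: inA B a; inB A b].
Proof.
have [sl s1 _] := tswap_morphism B A.
rewrite /sigma_sh_inf flipE expr0 scale1r sh_inf1_deg0 OmapE // s1 /=.
by rewrite !tswapE.
Qed.

(** * The cup product of the two partial derivatives *)

Section CupFunctional.
Variable k : comNzRingType.
Notation D := (dual k).
Notation T := (tens D D).

(** The coefficients of 1, x and y; the first tensor factor carries x and the second
carries y. *)
Definition xy_const (t : T) : k^o := (const_r t).1.
Definition xy_dx (t : T) : k^o := (const_r t).2.
Definition xy_dy (t : T) : k^o := (slope_r t).1.
Definition xy_cup (t0 t1 t2 : T) : k^o := xy_const t0 * xy_dx t1 * xy_dy t2.

Lemma xy_const_linear : linear xy_const.
Proof. by move=> c x y; rewrite /xy_const const_r_linear. Qed.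
Lemma xy_dx_linear : linear xy_dx.
Proof. by move=> c x y; rewrite /xy_dx const_r_linear. Qed.
Lemma xy_dy_linear : linear xy_dy.
Proof. by move=> c x y; rewrite /xy_dy slope_r_linear. Qed.

Lemma xy_constM s t : xy_const (s ∙ t) = xy_const s * xy_const t.
Proof. by rewrite /xy_const; have [_ _ ->] := const_r_morphism D. Qed.
Lemma xy_dxM s t : xy_dx (s ∙ t) = xy_const s * xy_dx t + xy_dx s * xy_const t.
Proof. by rewrite /xy_dx; have [_ _ ->] := const_r_morphism D. Qed.
Lemma xy_dyM s t : xy_dy (s ∙ t) = xy_dy s * xy_const t + xy_const s * xy_dy t.
Proof. by rewrite /xy_dy slope_r_derivation. Qed.
Lemma xy_const1 : xy_const kone = 1.
Proof. by rewrite /xy_const; have [_ -> _] := const_r_morphism D. Qed.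
Lemma xy_dx1 : xy_dx kone = 0.
Proof. by rewrite /xy_dx; have [_ -> _] := const_r_morphism D. Qed.
Lemma xy_dy1 : xy_dy kone = 0.
Proof.
by rewrite /xy_dy (derivation_kone (const_r_morphism D) (@slope_r_derivation k D)).
Qed.

Lemma const_l_const (t : T) : (const_l t).1 = xy_const t.
Proof.
move: t; apply: (tens_eq (P := k^o)).
- by move=> c x y; have [-> _ _] := const_l_morphism D.
- exact: xy_const_linear.
by move=> a b; rewrite /xy_const /const_l tswapE /const_r !eval_rE //= regularZ mulrC.
Qed.

Lemma const_l_slope (t : T) : (const_l t).2 = xy_dy t.
Proof.
move: t; apply: (tens_eq (P := k^o)).
- by move=> c x y; have [-> _ _] := const_l_morphism D.
- exact: xy_dy_linear.
by move=> a b; rewrite /xy_dy /const_l tswapE /const_r /slope_r !eval_rE //= !regularZ mulrC.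
Qed.

Lemma slope_l_const (t : T) : (slope_l t).1 = xy_dx t.
Proof.
move: t; apply: (tens_eq (P := k^o)).
- by move=> c x y; rewrite slope_l_linear.
- exact: xy_dx_linear.
by move=> a b; rewrite /xy_dx /slope_l tswapE /const_r /slope_r !eval_rE //= !regularZ mulrC.
Qed.

Lemma slope_l_slope (t : T) : (slope_l t).2 = (slope_r t).2.
Proof.
move: t; apply: (tens_eq (P := k^o)).
- by move=> c x y; rewrite slope_l_linear.
- by move=> c x y; rewrite slope_r_linear.
by move=> a b; rewrite /slope_l tswapE /slope_r !eval_rE //= !regularZ mulrC.
Qed.

Lemma xy_cup_normal : normal2 xy_cup.
Proof.
split=> [t1 t2 c x y|t0|t0 t2]; rewrite /xy_cup.
- by rewrite xy_const_linear !regularZ; ring.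
- split=> [t2 c x y|t1 c x y|t1].
  + by rewrite xy_dx_linear !regularZ; ring.
  + by rewrite xy_dy_linear !regularZ; ring.
  by rewrite xy_dy1 mulr0.
by rewrite xy_dx1 mulr0 mul0r.
Qed.

Definition cup := deg2_map xy_cup.
Lemma cup_linear : linear cup. Proof. exact: deg2_map_linear xy_cup_normal. Qed.
Lemma cupE t0 t1 t2 : cup (form t0 [:: t1; t2]) = xy_const t0 * xy_dx t1 * xy_dy t2.
Proof. exact: (deg2_mapE _ _ xy_cup_normal). Qed.

(** The terms of b cancel in pairs because d/dx and d/dy are derivations at the
point x = y = 0. *)
Lemma cup_b w : Omega_deg 3 w -> cup (hochschild_b w) = 0.
Proof.
have zl : linear (fun _ : Omega T => 0 : k^o) by move=> c x y; rewrite scaler0 addr0.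
apply: (Omega_deg_eq (linear_compose (@hochschild_b_linear _ _) cup_linear) zl).
move=> t0 [|t1 [|t2 [|t3 []]]] // _; rewrite hochschild_b3.
rewrite (linear_sub cup_linear) (linear_add cup_linear) (linear_sub cup_linear).
rewrite !cupE xy_dxM xy_dyM !xy_constM.
move: (xy_const t0) (xy_const t1) (xy_const t2) (xy_const t3) (xy_dx t1) (xy_dx t2)
  (xy_dy t2) (xy_dy t3) => a b c d e f g l.
by ring.
Qed.

Notation tau := (deg1_map (@dual_cocycle k)).
Let tauE a0 a1 : tau (form a0 [:: a1]) = dual_cocycle a0 a1.
Proof. exact: (deg1_mapE _ _ (dual_cocycle_normal k)). Qed.
Let tau_linear : linear tau. Proof. exact: deg1_map_linear (dual_cocycle_normal k). Qed.

(** The cup product can be evaluated by differentiating in y first or in x first; the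
next lemma is the second possibility.  The first applies to h0(dx (x) y), where x
is the variable of the natural endomorphism, the second to h0(x (x) dy). *)
Lemma cup_contract_last w : Omega_deg 2 w ->
  cup w = tau (contract_last (@const_r k D) (@slope_r k D) w).
Proof.
have cM := const_r_morphism D; have sM := @slope_r_derivation k D.
have sl := @slope_r_linear k D.
apply: (Omega_deg_eq cup_linear (linear_compose (contract_last_linear cM sl sM) tau_linear)).
move=> t0 [|t1 [|t2 []]] // _; rewrite cupE contract_lastE // tauE.
by rewrite /dual_cocycle /= -[(const_r t0).1]/(xy_const t0)
  -[(const_r t1).2]/(xy_dx t1) -[(slope_r t2).1]/(xy_dy t2); ring.
Qed.

Lemma cup_contract_first w : Omega_deg 2 w ->
  cup w = tau (contract_first (@const_l k D) (@slope_l k D) w).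
Proof.
have cM := const_l_morphism D; have sM := @slope_l_derivation k D.
have sl := @slope_l_linear k D.
apply: (Omega_deg_eq cup_linear (linear_compose (contract_first_linear cM sl sM) tau_linear)).
move=> t0 [|t1 [|t2 []]] // _; rewrite cupE contract_firstE // tauE.
by rewrite /dual_cocycle /= const_l_const const_l_slope slope_l_const; ring.
Qed.

(** The value of the cup product on B(t0 dt1) is the Jacobian of t0 and t1 at the
origin.  The two contractions also contain t0(0) times the coefficient of xy in
t1, and it cancels in the difference. *)
Lemma cup_connes w : Omega_deg 1 w ->
  cup (connes_B w) =
  deg0_map (@dual_slope k) (contract_last (@const_r k D) (@slope_r k D) w)
  - deg0_map (@dual_slope k) (contract_first (@const_l k D) (@slope_l k D) w).
Proof.
have crM := const_r_morphism D; have srM := @slope_r_derivation k D.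
have clM := const_l_morphism D; have slM := @slope_l_derivation k D.
have srl := @slope_r_linear k D; have sll := @slope_l_linear k D.
have ll := deg0_map_linear (@dual_slope_linear k).
have g1 := linear_compose (contract_last_linear crM srl srM) ll.
have g2 := linear_compose (contract_first_linear clM sll slM) ll.
have gl : linear (fun w => deg0_map (@dual_slope k) (contract_last (@const_r k D) (@slope_r k D) w)
  - deg0_map (@dual_slope k) (contract_first (@const_l k D) (@slope_l k D) w)).
  by move=> c x y; rewrite g1 g2 scalerBr opprD addrACA.
apply: (Omega_deg_eq (linear_compose (@connes_B_linear _ _) cup_linear) gl).
move=> t0 [|t1 []] // _; rewrite connes_B1 (linear_sub cup_linear) !cupE.
rewrite contract_lastE // contract_firstE // !(deg0_mapE _ _ (@dual_slope_linear k)).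
rewrite /dual_slope /= const_l_const const_l_slope slope_l_const slope_l_slope xy_const1.
rewrite -[(const_r t0).1]/(xy_const t0) -[(const_r t0).2]/(xy_dx t0) -[(slope_r t1).1]/(xy_dy t1).
move: (xy_const t0) (xy_dx t0) (xy_dy t0) (xy_dx t1) (xy_dy t1) (slope_r t1).2 => a b c d e f.
by ring.
Qed.
End CupFunctional.

(** * Nonexistence of a natural homotopy *)

Section NoHomotopy.
Variable k : comNzRingType.
Notation D := (dual k).
Variable h : forall A B : kalgType k,
  nat -> {linear tens (Omega A) (Omega B) -> Omega (tens A B)}.
Hypothesis h_deg : forall (A B : kalgType k) (i n : nat) (z : tens (Omega A) (Omega B)),
  tens_deg n z -> Omega_deg (n + 2 * i + 1)%N (h A B i z).
Hypothesis h_natural : forall (A A' B B' : kalgType k) (f : A -> A') (g : B -> B'),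
  kalg_morphism f -> kalg_morphism g ->
  forall (i : nat) (z : tens (Omega A) (Omega B)),
  h A' B' i (tmap (Omap f) (Omap g) z) = Omap (tmap f g) (h A B i z).
Hypothesis h_homotopy : forall (A B : kalgType k) (i : nat) (z : tens (Omega A) (Omega B)),
  sigma_sh_inf i z - sh_inf i z =
  ser_comp (bB_Omega (tens A B)) (fun j => h A B j) i z
  + ser_comp (fun j => h A B j) (bB_tens A B) i z.

Lemma hochschild_h0 (A B : kalgType k) (a0 : A) s (b0 : B) t :
  (size s + size t <= 1)%N ->
  hochschild_b (h A B 0 (form a0 s ⊗ form b0 t)) =
  - h A B 0 (tens_b (form a0 s ⊗ form b0 t)).
Proof.
move=> le1; have := h_homotopy 0 (form a0 s ⊗ form b0 t).
rewrite sigma_sh_low // subrr /ser_comp !big_ord1 /= => /esym/eqP.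
by rewrite addr_eq0 => /eqP.
Qed.

(** The natural endomorphisms obtained from h0 by inserting x in one tensor factor
and contracting it away. *)
Definition endo_l (A : kalgType k) (w : Omega A) : Omega A :=
  contract_last (@const_r k A) (@slope_r k A) (h A D 0 (w ⊗ form eps [::])).
Definition endo_r (B : kalgType k) (w : Omega B) : Omega B :=
  contract_first (@const_l k B) (@slope_l k B) (h D B 0 (form eps [::] ⊗ w)).

(** The sign is that of b h0 = - h0 b, since the contraction in the last entry
commutes with b. *)
Lemma endo_l_slope :
  deg1_map (@dual_cocycle k) (endo_l (form kone [:: eps : D])) =
  - deg0_map (@dual_slope k) (endo_l (form (eps : D) [::])).
Proof.
rewrite (@natural_endo_slope k endo_l (-1)) ?mulN1r // => [A|A A' f w fM|A u v|A u v].
- have [tl _] := tpure_bilin (Omega A) (Omega D).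
  have cl := contract_last_linear (const_r_morphism A) (@slope_r_linear k A)
    (@slope_r_derivation k A).
  by move=> c x y; rewrite /endo_l tl linearP cl.
- rewrite /endo_l -(contract_last_natural (const_r_morphism A) (@slope_r_linear k A)
    (@slope_r_derivation k A) (const_r_morphism A') (@slope_r_linear k A')
    (@slope_r_derivation k A') (F := tmap f (fun d : D => d))) //.
  + rewrite -(h_natural fM (id_morphism D)).
    have [fl f1 _] := fM; have [il i1 _] := id_morphism D.
    by rewrite tmapE ?OmapE //; apply: Omap_linear.
  + exact: (tmap_kalg_morphism fM (id_morphism D)).
  + by move=> t; apply: eval_r_natural; [case: fM | ].
  by move=> t; apply: eval_r_natural; [case: fM | ].
- apply: contract_last_deg.
  + exact: const_r_morphism.
  + exact: slope_r_linear.
  + exact: slope_r_derivation.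
  exact: (h_deg 0 (tens_deg_form u [:: v] eps [::])).
rewrite /endo_l -(contract_last_b (const_r_morphism A) (@slope_r_linear k A)
    (@slope_r_derivation k A)); last exact: (h_deg 0 (tens_deg_form u [:: v] eps [::])).
have cl := contract_last_linear (const_r_morphism A) (@slope_r_linear k A)
    (@slope_r_derivation k A).
rewrite hochschild_h0 // tens_bE hochschild_b0 tens0r addr0 scaleN1r.
by rewrite (linear_opp cl).
Qed.

(** No sign: the contraction in the first entry anticommutes with b, as h0 does. *)
Lemma endo_r_slope :
  deg1_map (@dual_cocycle k) (endo_r (form kone [:: eps : D])) =
  deg0_map (@dual_slope k) (endo_r (form (eps : D) [::])).
Proof.
rewrite (@natural_endo_slope k endo_r 1) ?mul1r // => [B|B B' f w fM|B u v|B u v].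
- have [_ tl] := tpure_bilin (Omega D) (Omega B).
  have cl := contract_first_linear (const_l_morphism B) (@slope_l_linear k B)
    (@slope_l_derivation k B).
  by move=> c x y; rewrite /endo_r tl linearP cl.
- rewrite /endo_r -(contract_first_natural (const_l_morphism B) (@slope_l_linear k B)
    (@slope_l_derivation k B) (const_l_morphism B') (@slope_l_linear k B')
    (@slope_l_derivation k B') (F := tmap (fun d : D => d) f)) //.
  + rewrite -(h_natural (id_morphism D) fM).
    have [fl f1 _] := fM; have [il i1 _] := id_morphism D.
    by rewrite tmapE ?OmapE //; apply: Omap_linear.
  + exact: (tmap_kalg_morphism (id_morphism D) fM).
  + move=> t; rewrite /const_l tswap_natural //; last by case: fM.
    by apply: eval_r_natural; [case: fM | ].
  move=> t; rewrite /slope_l tswap_natural //; last by case: fM.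
  by apply: eval_r_natural; [case: fM | ].
- apply: contract_first_deg.
  + exact: const_l_morphism.
  + exact: slope_l_linear.
  + exact: slope_l_derivation.
  exact: (h_deg 0 (tens_deg_form eps [::] u [:: v])).
have cl := contract_first_linear (const_l_morphism B) (@slope_l_linear k B)
    (@slope_l_derivation k B).
rewrite /endo_r scale1r -[LHS]opprK -(contract_first_b (const_l_morphism B) (@slope_l_linear k B)
    (@slope_l_derivation k B)); last exact: (h_deg 0 (tens_deg_form eps [::] u [:: v])).
rewrite hochschild_h0 // tens_bE hochschild_b0 tens0l add0r expr0 scale1r.
by rewrite (linear_opp cl) opprK.
Qed.

Lemma no_homotopy : False.
Proof.
pose z : tens (Omega D) (Omega D) := form eps [::] ⊗ form eps [::].
have cl := @cup_linear k.
have := congr1 (@cup k) (h_homotopy 1 z).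
rewrite sigma_sh_inf1_deg0 sh_inf1_deg0 /ser_comp !big_ord_recl !big_ord0 /= !addr0.
rewrite !(linear_sub cl) !(linear_add cl) !cupE.
rewrite cup_b; last exact: (h_deg 1 (tens_deg_form eps [::] eps [::])).
rewrite cup_connes; last exact: (h_deg 0 (tens_deg_form eps [::] eps [::])).
rewrite -/(tens_b z) /z tens_bE !hochschild_b0 tens0l tens0r addr0 linear0.
rewrite (linear_at0 cl) add0r addr0 tens_BE !connes_B0 expr0 scale1r linearD.
rewrite (linear_add cl) cup_contract_last;
  last exact: (h_deg 0 (tens_deg_form kone [:: eps] eps [::])).
rewrite cup_contract_first;
  last exact: (h_deg 0 (tens_deg_form eps [::] kone [:: eps])).
have := endo_l_slope; have := endo_r_slope; rewrite /endo_l /endo_r => -> ->.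
rewrite /bump /= subnn [- _ + _]addrC addrA subrK subrr.
rewrite xy_const1 /xy_dx /xy_dy /inA /inB /const_r /slope_r !eval_rE //=.
rewrite !regularZ /dual_const /dual_slope /= !mulr1 !mulr0 subr0 => /eqP.
by rewrite oner_eq0.
Qed.
End NoHomotopy.

Theorem proposition4p8 (k : comNzRingType) :
  ~ exists h : forall A B : kalgType k,
      nat -> {linear tens (Omega A) (Omega B) -> Omega (tens A B)},
    [/\ forall (A B : kalgType k) (i n : nat) (z : tens (Omega A) (Omega B)),
          tens_deg n z -> Omega_deg (n + 2 * i + 1)%N (h A B i z),
        forall (A A' B B' : kalgType k) (f : A -> A') (g : B -> B'),
          kalg_morphism f -> kalg_morphism g ->
          forall (i : nat) (z : tens (Omega A) (Omega B)),
            h A' B' i (tmap (Omap f) (Omap g) z) = Omap (tmap f g) (h A B i z)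
      & forall (A B : kalgType k) (i : nat) (z : tens (Omega A) (Omega B)),
          sigma_sh_inf i z - sh_inf i z =
            ser_comp (bB_Omega (tens A B)) (fun j => h A B j) i z
            + ser_comp (fun j => h A B j) (bB_tens A B) i z].
Proof.
by case=> h [h_deg h_natural h_homotopy]; exact: no_homotopy h_deg h_natural h_homotopy.
Qed.
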